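(* Let $\gamma>1$ and consider the $n$-level generalized random energy model with weights $a_1,\dots,a_n>0$, limiting proportions $p_1,\dots,p_n$, and driving distribution with density $\phi_{N,\gamma}$, as described in the context; let $0=\beta_0<\beta_1<\cdots<\beta_K<\beta_{K+1}=\infty$ and $0=r_0<r_1<\cdots<r_K=n$ be the numbers defined there. Then almost surely, for $\beta>0$, $$\lim_{N\to\infty}\frac1N\log Z_N(\beta)=\sum_{i=r_j+1}^np_i\log2+\frac{\gamma-1}\gamma\sum_{i=r_j+1}^n(\beta a_i)^{\frac\gamma{\gamma-1}}+\beta\sum_{l=1}^j\beta_l^{\frac1{\gamma-1}}\sum_{i=r_{l-1}+1}^{r_l}a_i^{\frac\gamma{\gamma-1}}$$ if $\beta_j<\beta\le\beta_{j+1}$, $0\le j\le K-1$, and $$\lim_{N\to\infty}\frac1N\log Z_N(\beta)=\beta\sum_{l=1}^K\beta_l^{\frac1{\gamma-1}}\sum_{i=r_{l-1}+1}^{r_l}a_i^{\frac\gamma{\gamma-1}}\quad\text{if }\beta>\beta_K.$$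
   Context: Model: fix $n\ge1$. For each $N\ge n$ let $k(1,N),\dots,k(n,N)\ge1$ be integers with $\sum_ik(i,N)=N$ and $\frac{k(i,N)}N\to p_i$ as $N\to\infty$, with $p_1>0$ (so $\sum_ip_i=1$). Write $\sigma\in\{+1,-1\}^N$ as $\sigma_1\cdots\sigma_n$ with $\sigma_i\in\{+1,-1\}^{k(i,N)}$. For each $N$ let $\xi(\sigma_1\cdots\sigma_i)$ $(1\le i\le n$, $\sigma_j\in\{+1,-1\}^{k(j,N)})$ be i.i.d. random variables with density $$\phi_{N,\gamma}(x)=\frac1{2\Gamma(\frac1\gamma)}\left(\frac\gamma N\right)^{\frac{\gamma-1}\gamma}e^{-\frac{|x|^\gamma}{\gamma N^{\gamma-1}}},\quad -\infty<x<\infty,$$ all $N$ on one probability space. The Hamiltonian is $H_N(\sigma)=\sum_{i=1}^na_i\xi(\sigma_1\cdots\sigma_i)$ and $Z_N(\beta)=\sum_\sigma e^{-\beta H_N(\sigma)}$. Constants: for $1\le j\le k\le n$ put $$B(j,k)=\left(\frac{(p_j+\cdots+p_k)\gamma\log2}{a_j^{\frac\gamma{\gamma-1}}+\cdots+a_k^{\frac\gamma{\gamma-1}}}\right)^{\frac{\gamma-1}\gamma}.$$ Set $r_0=0$ and, for $l\ge0$ as long as $r_l<n$, $\beta_{l+1}=\min_{k>r_l}B(r_l+1,k)$, $r_{l+1}=\max\{i>r_l:B(r_l+1,i)=\beta_{l+1}\}$. $K$ is the index with $r_K=n$; put $\beta_0=0$, $\beta_{K+1}=\infty$. *)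

(* Defs.v *)
From HB Require Import structures.
From mathcomp Require Import all_boot all_order all_algebra.
From mathcomp Require Import all_classical all_reals all_analysis.

Set Implicit Arguments.
Unset Strict Implicit.
Unset Printing Implicit Defensive.

Import Order.TTheory GRing.Theory Num.Theory.
Import numFieldNormedType.Exports.

Local Open Scope classical_set_scope.
Local Open Scope ring_scope.

Section Probability.
Context d (T : measurableType d) (R : realType) (P : probability T R).

Definition mutually_independent (I : finType) (X : I -> {RV P >-> R}) : Prop :=
  forall (J : {set I}) (A : I -> set R), (forall i, measurable (A i)) ->
    P (\bigcap_(i in [set` J]) X i @^-1` A i) =
    (\prod_(i in J) P (X i @^-1` A i))%E.

Definition has_density (X : {RV P >-> R}) (f : R -> R) : Prop :=
  forall A : set R, measurable A ->
    P (X @^-1` A) = (\int[lebesgue_measure]_(x in A) (f x)%:E)%E.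

End Probability.

Section DrivingDensity.
Context {R : realType}.

Definition Gamma (s : R) : R :=
  \int[lebesgue_measure]_(x in `]0, +oo[) (x `^ (s - 1) * expR (- x)).

Definition driving_density (N : nat) (gamma : R) (x : R) : R :=
  (2 * Gamma gamma^-1)^-1 * (gamma / N%:R) `^ ((gamma - 1) / gamma) *
  expR (- (`|x| `^ gamma / (gamma * N%:R `^ (gamma - 1)))).

End DrivingDensity.

(* Levels are numbered 1, ..., n; the values of level-indexed families at
   other naturals are never used.  [k i N] is the number of spins of level i. *)
Section Hierarchy.
Variable k : nat -> nat -> nat.

(* The spin +1 is [true], -1 is [false].  A configuration of length N is the
   concatenation of its blocks sigma_1 ... sigma_n, so sigma_1 ... sigma_i is
   its initial segment of length k(1,N) + ... + k(i,N). *)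
Definition prefix_len (N i : nat) : nat := (\sum_(1 <= j < i.+1) k j N)%N.

(* Since [prefix_len N i <= N] for i <= n, the default [true] is never read. *)
Definition spin_prefix (N i : nat) (s : N.-tuple bool) :
    (prefix_len N i).-tuple bool :=
  [tuple nth true s u | u < prefix_len N i].

(* All sigma_1 ... sigma_i with 1 <= i <= n; the ordinal is i - 1. *)
Definition spin_prefix_index (n N : nat) : finType :=
  {i : 'I_n & (prefix_len N i.+1).-tuple bool}.

Section Hamiltonian.
Context {R : realType} {T : Type}.
Variables (n : nat) (a : nat -> R).
Variable xi : forall N i : nat, (prefix_len N i).-tuple bool -> T -> R.

Definition hamiltonian (N : nat) (s : N.-tuple bool) (w : T) : R :=
  \sum_(1 <= i < n.+1) a i * xi (spin_prefix i s) w.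

Definition partition_function (N : nat) (beta : R) (w : T) : R :=
  \sum_(s : N.-tuple bool) expR (- beta * hamiltonian s w).

End Hamiltonian.
End Hierarchy.

Section CriticalValues.
Context {R : realType}.
Variables (n : nat) (gamma : R) (p a : nat -> R).

Definition B (j k : nat) : R :=
  ((\sum_(j <= i < k.+1) p i) * gamma * ln 2 /
   (\sum_(j <= i < k.+1) a i `^ (gamma / (gamma - 1))))
  `^ ((gamma - 1) / gamma).

(* For r < n, the minimum of B(r+1, k) over r < k <= n. *)
Definition next_beta (r : nat) : R :=
  \big[Num.min/B r.+1 n]_(r.+1 <= k < n.+1) B r.+1 k.

Definition next_r (r : nat) : nat :=
  (\max_(r.+1 <= i < n.+1 | B r.+1 i == next_beta r) i)%N.

(* [crit_r l] and [crit_beta l] are meaningful for l <= crit_K only. *)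
Definition crit_r (l : nat) : nat := iter l next_r 0%N.

Definition crit_beta (l : nat) : R :=
  if l is m.+1 then next_beta (crit_r m) else 0.

(* The r_l increase strictly until they reach n, so the first index with
   r_l = n is at most n. *)
Definition crit_K : nat := find (fun l => crit_r l == n) (iota 0 n.+1).

End CriticalValues.

(* Main.v *)
Require Import Defs.
From mathcomp Require Import all_boot all_order all_algebra.
From mathcomp Require Import all_classical all_reals all_analysis.
From mathcomp Require Import measurable_realfun.
From mathcomp Require Import measurable_fun_approximation.
From mathcomp Require Import ring lra.
Import Order.TTheory GRing.Theory Num.Theory.
Import numFieldNormedType.Exports.
Local Open Scope classical_set_scope.
Local Open Scope ring_scope.

(** Write [q = gamma / (gamma - 1)]. At scale [N] a driving variable exceeds
    [N * x] in absolute value with probability about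
    [exp (- N * x ^ gamma / gamma)], so configurations whose variable at level
    [i] is about [- N * x_i] have entropy [p_i * ln 2 - x_i ^ gamma / gamma] at
    that level, per unit of [N]. A choice of the [x_i] is realised exactly when
    the entropies of the levels [1..i] have a nonnegative sum for every [i],
    and the limit is the maximum, under these constraints, of
    [sum_i (p_i * ln 2 - x_i ^ gamma / gamma + beta * a_i * x_i)].
    The maximiser is [x_i = (b_i * a_i) ^ (1 / (gamma - 1))], where [b_i] is the
    critical value of the block of [i] if that block is frozen and [beta]
    otherwise ([level_beta]). It is feasible because each critical value is
    the minimum of the [B] over the initial segments of the remaining levels,
    and a frozen block, as a whole, has entropy zero ([level_beta_feasible],
    [gap_crit]).

    Upper bound ([free_energy_le]). Give level [i] of a configuration the
    weight [exp (theta * |xi| ^ gamma / (gamma * N ^ (gamma - 1)))] with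
    [theta < 1] close to [1]. Its mean is subexponential; taking
    [theta = 1 - m ^ (1 - gamma)] makes it exactly computable, because the
    density at scale [N] times the weight is a multiple of the density at scale
    [m * N]. By Markov's inequality and the Borel-Cantelli lemma, almost surely
    the total weight of the first [i] levels is eventually at most
    [exp (N / m)] times its mean ([ae_tilted_sums_bounded]). A single
    configuration cannot exceed the total, which is the entropy constraint.
    Young's inequality with slope [beta / b_i] at level [i] bounds its energy by
    the exponents of the weights; as the slopes decrease to at least [1], Abel
    summation uses the constraints for the excess of the slopes over [1], and
    the sum over configurations takes care of the rest.

    Lower bound ([free_energy_ge]). Shrinking the [x_i] slightly makes all the
    constraints strict, because [p_1 > 0]. Then the number of configurations
    with variables at least that low has relative variance exponentially small
    in [N] ([path_count_variance]), hence is almost surely at least half its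
    mean ([ae_level_counts_large]).

    The two bounds differ by the sum over [i] of
    [(beta / b_i - 1) * (p_i * ln 2 - (b_i * a_i) ^ q / gamma)], which vanishes:
    a level with [b_i <> beta] lies in a frozen block, on which [b] is constant
    and whose entropy is zero ([limit_free_energy_dual],
    [limit_free_energy_primal]). The exceptional events only involve integers
    and rational thresholds, not [beta]. *)

Set Implicit Arguments.
Unset Strict Implicit.
Unset Printing Implicit Defensive.

(** * Functions of independent variables and of variables with a density *)

Section Transfer.
Local Open Scope ereal_scope.
Import HBNNSimple.

Lemma integral_weight_nnsfun d1 d2 (X : measurableType d1)
    (S : measurableType d2) (R : realType) (mu : {measure set X -> \bar R})
    (phi : X -> S) (G : X -> R) (g : {nnsfun S >-> R}) :
  measurable_fun setT phi -> measurable_fun setT G ->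
  (forall x, 0 <= G x)%R ->
  \int[mu]_x ((G x)%:E * (g (phi x))%:E) =
  \sum_(r \in range g)
    r%:E * \int[mu]_(x in phi @^-1` (g @^-1` [set r])) (G x)%:E.
Proof.
move=> mphi /measurable_EFinP mG G0.
have mpre r : measurable (phi @^-1` (g @^-1` [set r])).
  by rewrite -[_ @^-1` _]setTI; exact: mphi.
have m1 r : measurable_fun setT (fun x => (G x)%:E *
    (\1_(phi @^-1` (g @^-1` [set r])) x)%:E).
  by apply: emeasurable_funM => //; exact/measurable_EFinP.
transitivity (\int[mu]_x \sum_(r \in range g)
    (r%:E * ((G x)%:E * (\1_(phi @^-1` (g @^-1` [set r])) x)%:E))).
  apply: eq_integral => x _.
  rewrite [in LHS]fimfunE -fsumEFin// ge0_mule_fsumr; last first.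
    by move=> r; rewrite nnfun_muleindic_ge0.
  by apply: eq_fsbigr => r _; rewrite EFinM muleCA.
have pos r x : 0 <= r%:E * ((G x)%:E * (\1_(phi @^-1` (g @^-1` [set r])) x)%:E).
  have [r0|r0] := leP 0%R r.
    by rewrite !mule_ge0// lee_fin.
  by rewrite preimage_nnfun0// preimage_set0 indic0 mule0 mule0.
rewrite ge0_integral_fsum//; last first.
  by move=> r; exact: measurable_funeM.
apply: eq_fsbigr => r /set_mem[s _ <-].
rewrite ge0_integralZl//; last 2 first.
- by move=> x _; rewrite mule_ge0// lee_fin.
- by rewrite lee_fin.
congr (_ * _); rewrite [RHS]integral_mkcond; apply: eq_integral => x _.
by rewrite patchE indicE; case: (x \in _); rewrite ?mule1 ?mule0.
Qed.

(** Simple functions are finite combinations of indicators, and monotone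
    convergence reaches the other functions. Having a density and being
    independent are both hypotheses about sets; through this lemma they apply
    to functions. *)
Lemma ge0_integral_transfer d1 d2 d3 (X : measurableType d1)
    (Y : measurableType d2) (S : measurableType d3) (R : realType)
    (mu : {measure set X -> \bar R}) (nu : {measure set Y -> \bar R})
    (phi : X -> S) (psi : Y -> S) (G : X -> R) (F : Y -> R) (h : S -> R) :
  measurable_fun setT phi -> measurable_fun setT psi ->
  measurable_fun setT G -> measurable_fun setT F ->
  (forall x, 0 <= G x)%R -> (forall y, 0 <= F y)%R ->
  (forall B, measurable B ->
    \int[mu]_(x in phi @^-1` B) (G x)%:E =
    \int[nu]_(y in psi @^-1` B) (F y)%:E) ->
  measurable_fun setT h -> (forall s, 0 <= h s)%R ->
  \int[mu]_x (G x * h (phi x))%:E = \int[nu]_y (F y * h (psi y))%:E.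
Proof.
move=> mphi mpsi mG mF G0 F0 GF /measurable_EFinP mh h0.
pose f_ := nnsfun_approx measurableT mh.
have lim d (Z : measurableType d) (la : {measure set Z -> \bar R})
    (chi : Z -> S) (H : Z -> R) : measurable_fun setT chi ->
    measurable_fun setT H -> (forall z, 0 <= H z)%R ->
    \int[la]_z (H z * h (chi z))%:E =
    limn (fun n => \int[la]_z ((H z)%:E * (f_ n (chi z))%:E)).
  move=> mchi mH H0; rewrite -monotone_convergence//.
  - apply: eq_integral => z _; apply/esym/cvg_lim => //.
    rewrite EFinM; apply: cvgeZl => //.
    by apply: (cvg_nnsfun_approx measurableT mh) => // s _; rewrite lee_fin.
  - move=> n; apply: emeasurable_funM; first exact/measurable_EFinP.
    by apply/measurable_EFinP; exact: measurableT_comp.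
  - by move=> n z _; rewrite mule_ge0// lee_fin.
  - move=> z _ m n mn; apply: lee_wpmul2l; first by rewrite lee_fin.
    by rewrite lee_fin; exact/lefP/nd_nnsfun_approx.
rewrite !lim//; congr (limn _); apply/funext => n.
rewrite !integral_weight_nnsfun//.
by apply: eq_fsbigr => r _; rewrite GF.
Qed.

End Transfer.

Section Independence.
Local Open Scope ereal_scope.
Context d (T : measurableType d) (R : realType) (P : probability T R).

Lemma measurable_RV (X : {RV P >-> R}) (B : set R) :
  measurable B -> measurable (X @^-1` B).
Proof. by move=> mB; rewrite -[_ @^-1` _]setTI; exact: measurable_funP. Qed.

Lemma probability_fine (D : set T) : measurable D -> P D = (fine (P D))%:E.
Proof. by move=> mD; rewrite fineK// fin_num_measure. Qed.

Lemma measurable_event (I : finType) (X : I -> {RV P >-> R}) (K : {set I})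
    (A : I -> set R) : (forall i, measurable (A i)) ->
  measurable (\bigcap_(i in [set` K]) X i @^-1` A i).
Proof.
by move=> mA; apply: fin_bigcap_measurable => // i _; exact: measurable_RV.
Qed.

Lemma independent_fine (I : finType) (X : I -> {RV P >-> R}) (K : {set I})
    (A : I -> set R) : mutually_independent X ->
  (forall i, measurable (A i)) ->
  P (\bigcap_(i in [set` K]) X i @^-1` A i) =
  (\prod_(i in K) fine (P (X i @^-1` A i)))%:E.
Proof.
move=> iX mA; rewrite iX// (big_morph EFin (@EFinM R) erefl).
by apply: eq_bigr => i _; apply: probability_fine; exact: measurable_RV.
Qed.

(** The variables are turned from events into functions one at a time, so the
    induction needs a mixed statement in which some of them (those in [K])
    still only contribute an event. *)
Lemma independent_expectation_prod_mixed (I : finType)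
    (X : I -> {RV P >-> R}) (g : I -> R -> R) (e : I -> R) :
  mutually_independent X ->
  (forall i, measurable_fun setT (g i)) -> (forall i x, 0 <= g i x)%R ->
  (forall i, \int[P]_w (g i (X i w))%:E = (e i)%:E) ->
  forall (l : seq I) (K : {set I}) (A : I -> set R), uniq l ->
  (forall i, i \in l -> i \notin K) -> (forall i, measurable (A i)) ->
  \int[P]_(w in \bigcap_(i in [set` K]) X i @^-1` A i)
     (\prod_(i <- l) g i (X i w))%:E =
  ((\prod_(i <- l) e i) * \prod_(i in K) fine (P (X i @^-1` A i)))%:E.
Proof.
move=> iX mg g0 ge.
have e0 i : (0 <= e i)%R.
  by rewrite -lee_fin -ge integral_ge0// => w _; rewrite lee_fin.
elim=> [|x l IH] K A /=.
  move=> _ _ mA; under eq_integral do rewrite big_nil.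
  rewrite big_nil mul1r integral_cst; last exact: measurable_event.
  by rewrite mul1e; exact: independent_fine.
move=> /andP[xl ul] lK mA.
set D := \bigcap_(i in _) _.
have mD : measurable D by exact: measurable_event.
have mprod : measurable_fun setT (fun w => \prod_(i <- l) g i (X i w))%R.
  by apply: measurable_prod => i _; exact: measurableT_comp.
pose c := ((\prod_(i <- l) e i) * \prod_(i in K) fine (P (X i @^-1` A i)))%R.
have c0 : (0 <= c)%R.
  by rewrite mulr_ge0// prodr_ge0// => i _; rewrite fine_ge0.
have prod0 w : (0 <= \prod_(i <- l) g i (X i w))%R by rewrite prodr_ge0.
transitivity
  (\int[P]_w ((\prod_(i <- l) g i (X i w))%R * \1_D w * g x (X x w))%:E).
  rewrite integral_mkcond epatch_indic; apply: eq_integral => w _ /=.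
  by rewrite big_cons -EFinM; congr EFin; ring.
rewrite (@ge0_integral_transfer _ _ _ _ _ _ _ P P (X x) (X x)
  (fun w => (\prod_(i <- l) g i (X i w))%R * \1_D w)%R (fun=> c) (g x))//.
- under eq_integral do rewrite EFinM.
  rewrite ge0_integralZl//; last 2 first.
  + by apply/measurable_EFinP; exact: measurableT_comp.
  + by move=> w _; rewrite lee_fin.
  by rewrite ge -EFinM big_cons; congr EFin; rewrite /c; ring.
- by apply: measurable_funM.
- by move=> w; rewrite mulr_ge0.
move=> B mB; rewrite integral_cst; last exact: measurable_RV.
pose A' := fun i => if i == x then B else A i.
have xK : x \notin K by apply: lK; rewrite inE eqxx.
have E1 : (X x @^-1` B) `&` D =
    \bigcap_(i in [set` (x |: K)%SET]) X i @^-1` A' i.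
  apply/seteqP; split=> w /=.
    move=> [wB wD] i /=; rewrite !inE /A' => /orP[/eqP ->|iK].
      by rewrite eqxx.
    by case: eqP iK xK => [->|_] iK; [rewrite iK|move=> _; exact: wD].
  move=> h; split.
    by have := h x; rewrite /= setU11 /A' eqxx; apply.
  move=> i /= iK; have := h i; rewrite /= !inE iK orbT /A'.
  by case: eqP iK xK => [->|_ _ _]; [move=> ->|apply].
transitivity (\int[P]_(w in (X x @^-1` B) `&` D)
    (\prod_(i <- l) g i (X i w))%:E).
  rewrite integral_mkcondr epatch_indic; apply: eq_integral => w _ /=.
  by rewrite EFinM.
rewrite E1 IH//; last first.
- by move=> i; rewrite /A'; case: eqP.
- move=> i il; rewrite !inE negb_or lK ?inE ?il ?orbT// andbT.
  by apply: contraNneq xl => <-.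
rewrite big_setU1//= {1}/A' eqxx probability_fine; last exact: measurable_RV.
rewrite -EFinM; congr EFin; rewrite /c.
have -> : (\prod_(i in K) fine (P (X i @^-1` A' i)) =
    \prod_(i in K) fine (P (X i @^-1` A i)))%R; last by ring.
apply: eq_bigr => i iK; rewrite /A'.
by case: eqP iK xK => [->|//] ->.
Qed.

Lemma independent_expectation_prod (I : finType)
    (X : I -> {RV P >-> R}) (g : I -> R -> R) (e : I -> R) (J : {set I}) :
  mutually_independent X ->
  (forall i, measurable_fun setT (g i)) -> (forall i x, 0 <= g i x)%R ->
  (forall i, \int[P]_w (g i (X i w))%:E = (e i)%:E) ->
  \int[P]_w (\prod_(i in J) g i (X i w))%:E = (\prod_(i in J) e i)%:E.
Proof.
move=> iX mg g0 ge.
have := @independent_expectation_prod_mixed I X g e iX mg g0 ge (enum J)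
  finset.set0 (fun=> setT) (enum_uniq _).
rewrite (_ : \bigcap_(i in _) _ = setT); last first.
  by apply/seteqP; split.
rewrite big_set0 mulr1 !big_enum/= => <-//.
- by apply: eq_integral => w _; rewrite big_enum.
- by move=> i _; rewrite inE.
Qed.

End Independence.

(** * Borel-Cantelli and second moments *)

Section AlmostSure.
Local Open Scope ereal_scope.
Context d (T : measurableType d) (R : realType) (P : probability T R).

Lemma geometric_nneseries_lty (C rho : R) : (0 <= rho < 1)%R ->
  \sum_(n <oo) (C * rho ^+ n)%:E < +oo.
Proof.
move=> /andP[r0 r1].
have /cvg_lim h : series (geometric C rho) @ \oo --> (C * (1 - rho)^-1)%R.
  by apply: cvg_geometric_series; rewrite ger0_norm.
rewrite (_ : (fun n => _) = EFin \o series (geometric C rho)); last first.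
  by apply/funext => n; rewrite /= /series/= -sumEFin big_mkord.
rewrite EFin_lim ?ltry//.
by apply/cvg_ex; eexists; apply: cvg_geometric_series; rewrite ger0_norm.
Qed.

(** Markov's inequality turns the bound on the means into the summable
    probabilities required by the first Borel-Cantelli lemma. *)
Lemma ae_eventually_le1 (f : nat -> T -> R) (C rho : R) :
  (0 <= rho < 1)%R ->
  (forall N, measurable_fun setT (f N)) -> (forall N w, 0 <= f N w)%R ->
  (\forall N \near \oo, \int[P]_w (f N w)%:E <= (C * rho ^+ N)%:E) ->
  {ae P, forall w, \forall N \near \oo, (f N w <= 1)%R}.
Proof.
move=> rho01 mf f0 [N0 _ hN].
pose F N := if (N0 <= N)%N then [set w | (1 < f N w)%R] else set0.
have mF N : measurable (F N).
  rewrite /F; case: ifP => // _.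
  rewrite (_ : [set w | _] = f N @^-1` `]1%R, +oo[).
    by rewrite -[_ @^-1` _]setTI; exact: mf.
  by apply/seteqP; split=> w /=; rewrite in_itv/= andbT.
have C0 : (0 <= C * rho ^+ N0)%R.
  by rewrite -lee_fin; apply: le_trans (hN N0 (leqnn _));
     apply: integral_ge0 => w _; rewrite lee_fin.
have PF N : (N0 <= N)%N -> P (F N) <= (C * rho ^+ N)%:E.
  move=> N0N; apply: le_trans (hN N N0N).
  rewrite -[F N]setIT -integral_indic//; apply: ge0_le_integral => //.
  - exact/measurable_EFinP/measurable_indic.
  - exact/measurable_EFinP.
  move=> w _; rewrite lee_fin indicE /F N0N.
  by case: (boolP (w \in _)) => [/set_mem/= /ltW|_]; rewrite ?f0.
have sF : \sum_(n <oo) P (F n) < +oo.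
  apply: le_lt_trans (geometric_nneseries_lty `|C| rho01).
  apply: lee_nneseries => // N _.
  have [N0N|NN0] := leqP N0 N.
    apply: le_trans (PF _ N0N) _; rewrite lee_fin ler_wpM2r ?ler_norm//.
    by rewrite exprn_ge0//; case/andP: rho01.
  rewrite /F leqNgt NN0/= measure0 lee_fin mulr_ge0// exprn_ge0//.
  by case/andP: rho01.
exists (lim_sup_set F); split.
- by apply: bigcapT_measurable => n; apply: bigcup_measurable => j _.
- exact: lim_sup_set_cvg0.
move=> w /= nev n _; apply: contrapT => hn.
apply: nev; exists (maxn n N0) => // N /=; rewrite geq_max => /andP[nN N0N].
rewrite leNgt; apply/negP => fN.
by apply: hn; exists N => //; rewrite /F N0N.
Qed.

End AlmostSure.

Section SecondMoment.
Local Open Scope ereal_scope.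
Context d (T : measurableType d) (R : realType) (P : probability T R).

Lemma integral_indic_comb (J : Type) (s : seq J) (c : J -> R)
    (D : J -> set T) : (forall j, measurable (D j)) ->
  P.-integrable setT (fun w => (\sum_(j <- s) c j * \1_(D j) w)%R%:E) /\
  \int[P]_w (\sum_(j <- s) c j * \1_(D j) w)%R%:E =
  (\sum_(j <- s) c j * fine (P (D j)))%:E.
Proof.
move=> mD; elim: s => [|j s [IH1 IH2]].
  split; first by under eq_fun do rewrite big_nil; exact: integrable0.
  by under eq_integral do rewrite big_nil; rewrite big_nil integral0.
have ij : P.-integrable setT (fun w => (c j * \1_(D j) w)%R%:E).
  under eq_fun do rewrite EFinM; apply: integrableZl => //.
  exact: integrable_indic.
split.
  under eq_fun do rewrite big_cons EFinD.
  exact: integrableD.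
under eq_integral do rewrite big_cons EFinD.
rewrite integralD// IH2 big_cons EFinD; congr (_ + _).
under eq_integral do rewrite EFinM.
rewrite integralZl//; last by exact: integrable_indic.
by rewrite integral_indic// setIT EFinM -probability_fine.
Qed.

Lemma integral_sum_indic_sub_sqr (I : finType) (A : I -> set T) (e : R) :
  (forall i, measurable (A i)) ->
  \int[P]_w ((\sum_i \1_(A i) w - e) ^+ 2)%R%:E =
  (\sum_i \sum_j fine (P (A i `&` A j)) - 2 * e * (\sum_i fine (P (A i)))
    + e ^+ 2)%R%:E.
Proof.
move=> mA.
have [i1 e1] := @integral_indic_comb _ (index_enum (I * I)%type) (fun=> 1%R)
  (fun p => A p.1 `&` A p.2) (fun p => measurableI _ _ (mA _) (mA _)).
have [i2 e2] := @integral_indic_comb _ (index_enum I) (fun=> - (2 * e))%R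
  A mA.
have [i3 e3] := @integral_indic_comb _ [:: tt] (fun=> e ^+ 2)%R
  (fun=> setT) (fun=> measurableT).
under eq_integral => w _.
  rewrite (_ : ((\sum_i _ - e) ^+ 2)%R =
    ((\sum_(p : I * I) 1 * \1_(A p.1 `&` A p.2) w) +
     (\sum_i (- (2 * e)) * \1_(A i) w) +
     (\sum_(j <- [:: tt]) e ^+ 2 * \1_setT w))%R); last first.
    rewrite big_seq1 indicT -mulr_sumr -(pair_bigA _
      (fun i j => 1 * \1_(A i `&` A j) w))%R/=.
    rewrite (_ : (\sum_i \sum_j _ =
        (\sum_i \1_(A i) w) * (\sum_j \1_(A j) w))%R).
      by ring.
    rewrite mulr_suml; apply: eq_bigr => i _; rewrite mulr_sumr.
    by apply: eq_bigr => j _; rewrite indicI mul1r.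
  rewrite !EFinD.
  over.
rewrite integralD//; last exact: integrableD.
rewrite integralD// e1 e2 e3 big_seq1 -!EFinD probability_setT /= mulr1.
congr EFin.
have -> : (\sum_i - (2 * e) * fine (P (A i)) =
    - (2 * e * \sum_i fine (P (A i))))%R by rewrite -mulr_sumr mulNr.
rewrite -(pair_bigA _ (fun i j => 1 * fine (P (A i `&` A j)))%R)/=.
by under eq_bigr do under eq_bigr do rewrite mul1r.
Qed.

End SecondMoment.

(** * Prefixes of spin configurations *)

Section SpinPrefixes.
Local Open Scope nat_scope.
Variables (k : nat -> nat -> nat) (N : nat).

Lemma prefix_len_mono i j : i <= j -> prefix_len k N i <= prefix_len k N j.
Proof.
move=> ij; rewrite /prefix_len [leqRHS](big_cat_nat (n := i.+1))//=.
exact: leq_addr.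
Qed.

Lemma spin_prefix_take i (s t : N.-tuple bool) : prefix_len k N i <= N ->
  (spin_prefix k i s == spin_prefix k i t) =
  (take (prefix_len k N i) s == take (prefix_len k N i) t).
Proof.
move=> KN; apply/eqP/eqP => [E|E].
  apply: (@eq_from_nth _ true); rewrite !size_takel ?size_tuple// => u uK.
  rewrite !nth_take//; have := congr1 (fun z => tnth z (Ordinal uK)) E.
  by rewrite !tnth_mktuple.
apply/eq_from_tnth => u; rewrite !tnth_mktuple.
by have := congr1 (fun z => nth true z u) E; rewrite !nth_take.
Qed.

Lemma spin_prefix_mono i j (s t : N.-tuple bool) : i <= j ->
  prefix_len k N j <= N -> spin_prefix k j s = spin_prefix k j t ->
  spin_prefix k i s = spin_prefix k i t.
Proof.
move=> ij jN /eqP; rewrite spin_prefix_take// => /eqP E.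
have KK := prefix_len_mono ij.
apply/eqP; rewrite spin_prefix_take ?(leq_trans KK)//.
by have := congr1 (take (prefix_len k N i)) E; rewrite !take_takel// => ->.
Qed.

Lemma card_same_prefix i (s : N.-tuple bool) : prefix_len k N i <= N ->
  #|[set t : N.-tuple bool | spin_prefix k i t == spin_prefix k i s]%SET| =
  2 ^ (N - prefix_len k N i).
Proof.
set K := prefix_len k N i => KN.
have sz (v : (N - K).-tuple bool) : size (take K s ++ v) == N.
  by rewrite size_cat size_takel ?size_tuple// subnKC.
pose h v := Tuple (sz v).
rewrite (_ : [set t | _]%SET = [set h v | v in [set: (N - K).-tuple bool]])%SET.
  rewrite card_imset; first by rewrite cardsT card_tuple card_bool.
  move=> v v' /(congr1 val)/= /eqP; rewrite eqseq_cat// eqxx/= => /eqP vv'.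
  exact: val_inj.
apply/setP => t; rewrite inE spin_prefix_take//.
apply/eqP/imsetP => [E|[v _ ->]].
  have szd : size (drop K t) == N - K by rewrite size_drop size_tuple.
  exists (Tuple szd) => //; apply: val_inj => /=.
  by rewrite -E cat_take_drop.
by rewrite /= take_size_cat// size_takel// size_tuple.
Qed.

End SpinPrefixes.

Section PrefixSets.
Variables (k : nat -> nat -> nat) (n N : nat).

Definition prefix_at (s : N.-tuple bool) (i : 'I_n) : spin_prefix_index k n N :=
  Tagged (fun i : 'I_n => (prefix_len k N i.+1).-tuple bool)
    (spin_prefix k i.+1 s).

Definition prefixes (s : N.-tuple bool) : {set spin_prefix_index k n N} :=
  [set prefix_at s i | i in [set: 'I_n]]%SET.

Lemma prefix_at_inj s : injective (prefix_at s).
Proof. by move=> i j /(congr1 tag). Qed.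

Lemma prefix_at_eq s t i :
  (prefix_at s i == prefix_at t i) =
  (spin_prefix k i.+1 s == spin_prefix k i.+1 t).
Proof. by rewrite eq_Tagged. Qed.

Lemma prod_prefixes (R : comPzRingType) (f : 'I_n -> R) s :
  \prod_(u in prefixes s) f (tag u) = \prod_i f i.
Proof.
rewrite /prefixes big_imset/=; last by move=> i j _ _; exact: prefix_at_inj.
by apply: eq_bigl => i; rewrite inE.
Qed.

(** A prefix common to both configurations carries a single variable, hence a
    single factor. *)
Lemma prod_prefixes_pair (R : comPzRingType) (f : 'I_n -> R) s t :
  \prod_(u in (prefixes s :|: prefixes t)%SET) f (tag u) =
  \prod_i f i *
  \prod_(i < n | spin_prefix k i.+1 s != spin_prefix k i.+1 t) f i.
Proof.
rewrite (big_setID (prefixes s))/= finset.setUK finset.setDUl.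
rewrite finset.setDv finset.set0U prod_prefixes.
congr (_ * _).
rewrite (_ : prefixes t :\: prefixes s = [set prefix_at t i | i in
   [set i : 'I_n | spin_prefix k i.+1 s != spin_prefix k i.+1 t]])%SET.
  rewrite big_imset/=; last by move=> i j _ _; exact: prefix_at_inj.
  by apply: eq_bigl => i; rewrite inE.
apply/setP => u; rewrite inE; apply/andP/imsetP => [[us /imsetP[i _ E]]|[i]].
  exists i => //; rewrite inE -prefix_at_eq; apply: contraNneq us => E'.
  by rewrite E -E' imset_f.
rewrite inE -prefix_at_eq => st ->; split; last exact: imset_f.
apply: contraNN st => /imsetP[j _ E].
by have /= := congr1 tag E => ij; rewrite E ij.
Qed.

End PrefixSets.

(** * Fluctuations of the number of paths *)

Section CountingPaths.
Context d (T : measurableType d) (R : realType) (P : probability T R).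
Variables (k : nat -> nat -> nat) (n N : nat).
Variable X : spin_prefix_index k n N -> {RV P >-> R}.
Hypothesis indX : mutually_independent X.
Hypothesis kN : (prefix_len k N n <= N)%N.

Let kiN (i : 'I_n) : (prefix_len k N i.+1 <= N)%N.
Proof. exact: leq_trans (prefix_len_mono _ _ (ltn_ord i)) kN. Qed.

Definition path_event (A : 'I_n -> set R) (s : N.-tuple bool) : set T :=
  \bigcap_(u in [set` prefixes k n s]) X u @^-1` A (tag u).

Definition path_count (A : 'I_n -> set R) (w : T) : R :=
  \sum_(s : N.-tuple bool) \1_(path_event A s) w.

Variables (A : 'I_n -> set R) (pr : 'I_n -> R).
Hypothesis mA : forall i, measurable (A i).
Hypothesis pr_gt0 : forall i, 0 < pr i.
Hypothesis PA : forall u, P (X u @^-1` A (tag u)) = (pr (tag u))%:E.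

Lemma measurable_path_event s : measurable (path_event A s).
Proof.
exact: (@measurable_event _ _ _ P _ X (prefixes k n s) (fun u => A (tag u))).
Qed.

Lemma probability_path_event s : fine (P (path_event A s)) = \prod_i pr i.
Proof.
rewrite /path_event (@independent_fine _ _ _ P _ X _ (fun u => A (tag u)))//=.
by under eq_bigr do rewrite PA/=; exact: prod_prefixes.
Qed.

Lemma probability_path_event2 s t :
  fine (P (path_event A s `&` path_event A t)) = (\prod_i pr i) ^+ 2 *
  \prod_(i < n | spin_prefix k i.+1 s == spin_prefix k i.+1 t) (pr i)^-1.
Proof.
rewrite /path_event -bigcap_setU.
rewrite (_ : [set` _] `|` [set` _] =
  [set` (prefixes k n s :|: prefixes k n t)%SET]); last first.
  apply/seteqP; split=> u /=; rewrite inE; first by case=> ->; rewrite ?orbT.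
  by case/orP; [left|right].
rewrite (@independent_fine _ _ _ P _ X _ (fun u => A (tag u)))//=.
under eq_bigr do rewrite PA/=.
rewrite prod_prefixes_pair expr2 -mulrA; congr (_ * _).
rewrite [in RHS](bigID (fun i : 'I_n =>
  spin_prefix k i.+1 s == spin_prefix k i.+1 t))/= mulrAC -big_split/=.
rewrite [X in _ = X * _]big1 ?mul1r// => i _.
by rewrite divff// gt_eqF.
Qed.

(** Two configurations agree exactly on an initial segment of the levels, so
    the product on the left is one of the terms on the right: the constant if
    they differ from the start, otherwise the term of the last level of
    agreement. *)
Lemma prod_agreement_le (s t : N.-tuple bool) :
  \prod_(i < n | spin_prefix k i.+1 s == spin_prefix k i.+1 t) (pr i)^-1 <=
  1 + \sum_(i < n) (spin_prefix k i.+1 t == spin_prefix k i.+1 s)%:R *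
        \prod_(j < n | (j <= i)%N) (pr j)^-1.
Proof.
have nng (i : 'I_n) : 0 <= \prod_(j < n | (j <= i)%N) (pr j)^-1.
  by apply: prodr_ge0 => j _; rewrite invr_ge0 ltW.
case: (pickP (fun i : 'I_n => spin_prefix k i.+1 s == spin_prefix k i.+1 t)).
  move=> i0 i0st; have [i ist imax] := @arg_maxnP _ i0
    (fun i : 'I_n => spin_prefix k i.+1 s == spin_prefix k i.+1 t)
    (fun i => val i) i0st.
  rewrite [in leRHS](bigD1 i)//= eq_sym ist mul1r.
  rewrite (eq_bigl (fun j : 'I_n => (j <= i)%N)); last first.
    move=> j; apply/idP/idP => [/imax//|ji].
    by apply/eqP; apply: spin_prefix_mono (eqP ist).
  rewrite addrCA lerDl addr_ge0// sumr_ge0// => j _.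
  by rewrite mulr_ge0.
move=> none; rewrite big_pred0// lerDl sumr_ge0// => i _.
by rewrite mulr_ge0.
Qed.

Let M := 2 ^+ N * \prod_i pr i.

Lemma sum_path_event2_le :
  \sum_(s : N.-tuple bool) \sum_(t : N.-tuple bool)
    fine (P (path_event A s `&` path_event A t)) <=
  M ^+ 2 * (1 + \sum_(i < n)
     (2 ^+ prefix_len k N i.+1)^-1 * \prod_(j < n | (j <= i)%N) (pr j)^-1).
Proof.
apply: (@le_trans _ _ (\sum_(s : N.-tuple bool) (\prod_i pr i) ^+ 2 *
   (2 ^+ N + \sum_(i < n) (2 ^+ (N - prefix_len k N i.+1)) *
     \prod_(j < n | (j <= i)%N) (pr j)^-1))).
  apply: ler_sum => s _.
  rewrite (eq_bigr _ (fun t _ => probability_path_event2 s t)).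
  rewrite -mulr_sumr ler_wpM2l ?sqr_ge0//.
  apply: le_trans (ler_sum _ (fun t _ => prod_agreement_le s t)) _.
  rewrite big_split/= sumr_const card_tuple card_bool -natrX lerD//.
  rewrite exchange_big/=; apply: ler_sum => i _; rewrite -mulr_suml.
  rewrite ler_wpM2r//.
    by apply: prodr_ge0 => j _; rewrite invr_ge0 ltW.
  rewrite -natr_sum -natrX -(card_same_prefix s (kiN i)) -sum1_card ler_nat.
  rewrite [leqRHS]big_mkcond/=; apply: leq_sum => t _.
  by rewrite inE; case: eqP.
rewrite sumr_const card_tuple card_bool -[_ *+ _]mulr_natl natrX.
set S' := \sum_(i < n) _^-1 * _.
rewrite (_ : M ^+ 2 * _ =
  2 ^+ N * ((\prod_i pr i) ^+ 2 * (2 ^+ N + 2 ^+ N * S'))); last first.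
  by rewrite /M; ring.
rewrite ler_wpM2l ?exprn_ge0// ler_wpM2l ?sqr_ge0// lerD2l mulr_sumr.
apply: ler_sum => i _; rewrite mulrA ler_wpM2r//.
  by apply: prodr_ge0 => j _; rewrite invr_ge0 ltW.
by rewrite expfB_cond// pnatr_eq0; exact: kiN.
Qed.

(** Only pairs of configurations with a common initial segment are
    correlated. Relative to the square of the mean, the pairs that share a
    given number of levels contribute the inverse of the expected number of
    admissible initial segments of that length. *)
Lemma path_count_variance :
  (\int[P]_w (((path_count A w - M) / (M / 2)) ^+ 2)%:E <=
   (4 * \sum_(i < n) (2 ^+ prefix_len k N i.+1)^-1 *
         \prod_(j < n | (j <= i)%N) (pr j)^-1)%:E)%E.
Proof.
have M0 : 0 < M by rewrite mulr_gt0 ?exprn_gt0// prodr_gt0.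
under eq_integral do rewrite exprMn mulrC EFinM.
rewrite ge0_integralZl//; last 3 first.
- apply/measurable_EFinP; apply: measurable_funX; apply: measurable_funB => //.
  apply: measurable_sum => s; apply: measurable_indic.
  exact: measurable_path_event.
- by move=> w _; rewrite lee_fin sqr_ge0.
- by rewrite lee_fin sqr_ge0.
rewrite integral_sum_indic_sub_sqr; last exact: measurable_path_event.
rewrite -EFinM lee_fin.
have -> : \sum_s fine (P (path_event A s)) = M.
  rewrite (eq_bigr _ (fun s _ => probability_path_event s)).
  by rewrite sumr_const card_tuple card_bool -[_ *+ _]mulr_natl natrX.
set S2 := \sum_(i < n) _.
apply: (@le_trans _ _ ((M / 2)^-1 ^+ 2 * (M ^+ 2 * S2))).
  rewrite ler_wpM2l ?sqr_ge0//.
  apply: (@le_trans _ _ (M ^+ 2 * (1 + S2) - 2 * M * M + M ^+ 2)); last by lra.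
  by rewrite !lerD2r; exact: sum_path_event2_le.
rewrite mulrA ler_wpM2r//.
  apply: sumr_ge0 => i _; rewrite mulr_ge0// ?invr_ge0 ?exprn_ge0//.
  by apply: prodr_ge0 => j _; rewrite invr_ge0 ltW.
rewrite invf_div expr_div_n -mulrA mulVf ?mulr1 ?gt_eqF ?exprn_gt0//; lra.
Qed.

End CountingPaths.

(** * The driving density *)

Section DrivingDensity.
Variables (R : realType) (gamma : R).
Hypothesis gamma_gt1 : 1 < gamma.

Local Notation e := ((gamma - 1) / gamma).
Local Notation C0 := (2 * Gamma gamma^-1)^-1.

Let gamma_gt0 : 0 < gamma. Proof. exact: lt_trans gamma_gt1. Qed.

Lemma normalization_ge0 : 0 <= C0.
Proof.
rewrite invr_ge0 mulr_ge0// Rintegral_ge0// => x _.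
by rewrite mulr_ge0// ?powR_ge0 ?expR_ge0.
Qed.

Lemma driving_density_ge0 N x : 0 <= driving_density N gamma x.
Proof.
by rewrite /driving_density !mulr_ge0 ?expR_ge0 ?powR_ge0 ?normalization_ge0.
Qed.

Lemma measurable_norm_powR (c : R) :
  measurable_fun setT (fun x : R => `|x| `^ c).
Proof. exact: (measurableT_comp (measurable_powR c)). Qed.

Lemma measurable_driving_density N :
  measurable_fun setT (driving_density N gamma).
Proof.
apply: measurable_funM => //; apply: measurableT_comp => //.
apply: measurableT_comp => //; apply: measurable_funM => //.
exact: measurable_norm_powR.
Qed.

(** The weight that will be attached to a variable at scale [N]: the density
    at scale [N] times this weight is proportional to the density at the
    coarser scale [m * N], so that its mean needs no integration. *)
Definition tilt (m N : nat) (x : R) : R :=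
  expR ((1 - (m%:R `^ (gamma - 1))^-1) *
        (`|x| `^ gamma / (gamma * N%:R `^ (gamma - 1)))).

Lemma tilt_ge0 m N x : 0 <= tilt m N x. Proof. exact: expR_ge0. Qed.

Lemma measurable_tilt m N : measurable_fun setT (tilt m N).
Proof.
apply: measurableT_comp => //; apply: measurable_funM => //.
by apply: measurable_funM => //; exact: measurable_norm_powR.
Qed.

Lemma tilt_density m N x : (0 < m)%N -> (0 < N)%N ->
  driving_density N gamma x * tilt m N x =
  m%:R `^ e * driving_density (m * N) gamma x.
Proof.
move=> m0 N0; rewrite /driving_density /tilt -[LHS]mulrA -expRD.
have mR : 0 < m%:R :> R by rewrite ltr0n.
have NR : 0 < N%:R :> R by rewrite ltr0n.
have -> : gamma / N%:R = m%:R * (gamma / (m * N)%:R).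
  by rewrite natrM; field; rewrite !gt_eqF.
rewrite powRM ?ler0n ?divr_ge0 ?(ltW gamma_gt0)//.
have pm : m%:R `^ (gamma - 1) != 0 by rewrite gt_eqF ?powR_gt0.
have pN : N%:R `^ (gamma - 1) != 0 by rewrite gt_eqF ?powR_gt0.
rewrite (_ : - _ + _ =
   - (`|x| `^ gamma / (gamma * (m * N)%:R `^ (gamma - 1)))).
  by ring.
rewrite natrM powRM ?ler0n//; field.
by rewrite pm pN gt_eqF.
Qed.

Section OneVariable.
Context d (T : measurableType d) (P : probability T R).
Variables (N : nat) (X : {RV P >-> R}).
Hypothesis N_gt0 : (0 < N)%N.
Hypothesis dX : has_density X (driving_density N gamma).

(** The total mass of the density, and with it the sign of the normalization,
    is read off from the existence of a variable, without evaluating the Gamma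
    integral. *)
Lemma driving_density_integral1 :
  (\int[lebesgue_measure]_x (driving_density N gamma x)%:E = 1)%E.
Proof. by rewrite -dX// preimage_setT probability_setT. Qed.

Lemma normalization_gt0 : 0 < C0.
Proof.
rewrite lt_neqAle normalization_ge0 andbT; apply/eqP => C00.
have := driving_density_integral1.
under eq_integral do rewrite /driving_density -C00 !mul0r.
by rewrite integral0 => /eqP; rewrite eqe eq_sym oner_eq0.
Qed.

Lemma expectation_density (h : R -> R) : measurable_fun setT h ->
  (forall x, 0 <= h x) ->
  (\int[P]_w (h (X w))%:E =
   \int[lebesgue_measure]_x (driving_density N gamma x * h x)%:E)%E.
Proof.
move=> mh h0.
rewrite -(@ge0_integral_transfer _ _ _ T (measurableTypeR R)
  (measurableTypeR R) _ P lebesgue_measure X id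
  (fun=> 1) (driving_density N gamma) h)//.
- by under [RHS]eq_integral do rewrite mul1r.
- by move=> _ B mB; rewrite setTI; exact: measurable_RV.
- exact: measurable_driving_density.
- exact: driving_density_ge0.
move=> B mB; rewrite integral_cst; last exact: measurable_RV.
by rewrite mul1e; exact: dX.
Qed.

Lemma expectation_tilt m (Y : {RV P >-> R}) : (0 < m)%N ->
  has_density Y (driving_density (m * N) gamma) ->
  (\int[P]_w (tilt m N (X w))%:E = (m%:R `^ e)%:E)%E.
Proof.
move=> m0 dY; rewrite expectation_density; first last.
- exact: tilt_ge0.
- exact: measurable_tilt.
under eq_integral do rewrite tilt_density// EFinM.
rewrite ge0_integralZl//.
- rewrite -[in RHS](mule1 (m%:R `^ e)%:E) -(@dY setT)//.
  by rewrite preimage_setT probability_setT.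
- by apply/measurable_EFinP; exact: measurable_driving_density.
- by move=> x _; rewrite lee_fin driving_density_ge0.
Qed.

Definition lower_tail (M : nat) (y : R) : R :=
  fine (\int[lebesgue_measure]_(x in `]-oo, (- (M%:R * y))%R])
    (driving_density M gamma x)%:E).

Lemma probability_lower_tail y :
  P (X @^-1` `]-oo, (- (N%:R * y))]) = (lower_tail N y)%:E.
Proof.
rewrite /lower_tail -dX//; apply: probability_fine; exact: measurable_RV.
Qed.

(** The density at [- N * y'] times the length [N * (y' - y)] of an interval on
    which it is smallest at that end. The factor [N] compensates the decay of
    the normalization [(gamma / N) ^ ((gamma - 1) / gamma)]. *)
Lemma lower_tail_ge y y' : 0 <= y -> y < y' ->
  (y' - y) * C0 * gamma `^ e * expR (- (N%:R * (y' `^ gamma / gamma)))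
  <= lower_tail N y.
Proof.
move=> y0 yy'; rewrite -lee_fin -probability_lower_tail dX//.
have NR : 0 < N%:R :> R by rewrite ltr0n.
have NR1 : 1 <= N%:R :> R by rewrite ler1n.
have y'0 : 0 < y' by exact: le_lt_trans yy'.
pose I := Interval (BLeft (- (N%:R * y'))) (BRight (- (N%:R * y))).
have e1 : e <= 1 by rewrite ler_pdivrMr// mul1r gerBl.
pose c := C0 * (gamma / N%:R) `^ e * expR (- (N%:R * (y' `^ gamma / gamma))).
apply: (@le_trans _ _ (\int[lebesgue_measure]_(x in [set` I]) c%:E)%E).
  rewrite integral_cst//= (lebesgue_measure_itv I)/=.
  rewrite lte_fin ltrN2 ltr_pM2l// yy'.
  rewrite -EFinB -EFinM lee_fin.
  rewrite /c powRM ?invr_ge0 ?(ltW gamma_gt0) ?(ltW NR)//.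
  have -> : - (N%:R * y) - - (N%:R * y') = N%:R * (y' - y) by ring.
  set E := expR _; rewrite [leRHS](_ : _ =
    (y' - y) * C0 * gamma `^ e * E * (N%:R * N%:R^-1 `^ e)); last by ring.
  rewrite ler_peMr//.
    by rewrite !mulr_ge0 ?expR_ge0 ?powR_ge0 ?normalization_ge0 ?subr_ge0 ?ltW.
  rewrite -powR_inv1 ?(ltW NR)// -powRrM mulN1r powRN.
  rewrite ler_pdivlMr ?powR_gt0// mul1r.
  by apply: ler1_powR.
apply: (@le_trans _ _ (\int[lebesgue_measure]_(x in [set` I])
    (driving_density N gamma x)%:E)%E).
  apply: ge0_le_integral => //.
  - move=> x _; rewrite lee_fin /c.
    by rewrite !mulr_ge0 ?expR_ge0 ?powR_ge0 ?normalization_ge0.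
  - apply: measurable_funTS; apply/measurable_EFinP.
    exact: measurable_driving_density.
  move=> x; rewrite /I/= in_itv/= => /andP[x1 x2]; rewrite lee_fin /c.
  rewrite ler_wpM2l ?mulr_ge0 ?powR_ge0 ?normalization_ge0// ler_expR lerN2.
  have xn : `|x| <= N%:R * y'.
    rewrite ler0_norm; first lra.
    by apply: le_trans x2 _; rewrite oppr_le0 mulr_ge0// ltW.
  rewrite ler_pdivrMr ?mulr_gt0 ?powR_gt0//.
  apply: (@le_trans _ _ ((N%:R * y') `^ gamma)).
    apply: ge0_ler_powR => //; rewrite ?nnegrE ?(ltW gamma_gt0)//.
    by rewrite mulr_ge0 ?(ltW NR) ?(ltW y'0).
  rewrite powRM ?(ltW NR) ?(ltW y'0)// -(mulr_powRB1 (ltW NR) gamma_gt0).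
  by rewrite le_eqVlt; apply/orP; left; apply/eqP; field; rewrite gt_eqF.
apply: ge0_subset_integral => //.
- apply: measurable_funTS; apply/measurable_EFinP.
  exact: measurable_driving_density.
- by move=> x _; rewrite lee_fin driving_density_ge0.
by move=> x; rewrite /I/= !in_itv/= => /andP[].
Qed.

End OneVariable.
End DrivingDensity.

(** * Events of full probability *)

Section AlmostSureEstimates.
Context d (T : measurableType d) (R : realType) (P : probability T R).

Lemma ae_forall_count (C : countType) (Q : C -> T -> Prop) :
  (forall c, {ae P, forall w, Q c w}) -> {ae P, forall w c, Q c w}.
Proof.
move=> aeQ.
have : {ae P, forall w m, if (unpickle m : option C) is Some c then Q c w
                          else True}.
  by apply: ae_foralln => m; case: unpickle => [c|]; [exact: aeQ|exact: aeW].
by apply: filterS => w h c; have := h (pickle c); rewrite pickleK.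
Qed.

Variables (k : nat -> nat -> nat) (n : nat) (gamma : R).
Variable xi : forall N i : nat, (prefix_len k N i).-tuple bool -> {RV P >-> R}.
Arguments xi : clear implicits.
Hypothesis n_ge1 : (1 <= n)%N.
Hypothesis gamma_gt1 : 1 < gamma.
Hypothesis kN : forall N, (n <= N)%N -> (prefix_len k N n <= N)%N.
Hypothesis xi_indep : forall N, (n <= N)%N ->
  mutually_independent
    (fun u : spin_prefix_index k n N => xi N (tag u).+1 (tagged u)).
Hypothesis xi_density : forall N i (s : (prefix_len k N i).-tuple bool),
  (n <= N)%N -> (1 <= i <= n)%N ->
  has_density (xi N i s) (driving_density N gamma).

Local Notation e := ((gamma - 1) / gamma).

Definition level_var N (u : spin_prefix_index k n N) : {RV P >-> R} :=
  xi N (tag u).+1 (tagged u).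

(** The sum runs over whole configurations, so the weight of an initial segment
    of length [K] is counted [2 ^ (N - K)] times, once for each continuation. *)
Definition tilted_sum (m i N : nat) (w : T) : R :=
  \sum_(s : N.-tuple bool) \prod_(j < n | (j < i)%N)
    tilt gamma m N (xi N j.+1 (spin_prefix k j.+1 s) w).

Lemma measurable_tilted_term (m i N : nat) (s : N.-tuple bool) :
  measurable_fun setT (fun w => \prod_(j < n | (j < i)%N)
    tilt gamma m N (xi N j.+1 (spin_prefix k j.+1 s) w)).
Proof.
rewrite (_ : (fun w => _) = fun w => \prod_(j < n)
  (if (j < i)%N then tilt gamma m N (xi N j.+1 (spin_prefix k j.+1 s) w)
   else 1)); last by apply/funext => w; rewrite big_mkcond.
apply: measurable_prod => j _; case: (_ < _)%N => //.
by apply: measurableT_comp => //; exact: measurable_tilt.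
Qed.

Lemma expectation_tilted_sum m i N : (0 < m)%N -> (n <= N)%N ->
  (\int[P]_w (tilted_sum m i N w)%:E =
   (2 ^+ N * (\prod_(j < n | (j < i)%N) m%:R `^ e))%:E)%E.
Proof.
move=> m0 nN; rewrite /tilted_sum.
have N0 : (0 < N)%N by exact: leq_trans nN.
transitivity (\int[P]_w \sum_(s : N.-tuple bool) (\prod_(j < n | (j < i)%N)
    tilt gamma m N (xi N j.+1 (spin_prefix k j.+1 s) w))%:E)%E.
  by apply: eq_integral => w _; rewrite sumEFin.
rewrite ge0_integral_sum//; last 2 first.
- by move=> s; apply/measurable_EFinP; exact: measurable_tilted_term.
- move=> s w _; rewrite lee_fin prodr_ge0// => j _; exact: tilt_ge0.
rewrite (eq_bigr (fun=> (\prod_(j < n | (j < i)%N) m%:R `^ e)%:E)); last first.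
  move=> s _.
  pose J := [set prefix_at k s j | j in [set j : 'I_n | (j < i)%N]]%SET.
  have prodJ (f : spin_prefix_index k n N -> R) :
      \prod_(u in J) f u = \prod_(j < n | (j < i)%N) f (prefix_at k s j).
    rewrite big_imset/=; last by move=> a b _ _; exact: prefix_at_inj.
    by apply: eq_bigl => j; rewrite inE.
  rewrite -(prodJ (fun=> m%:R `^ e)) -(@independent_expectation_prod _ _ _ P _
    (@level_var N) (fun=> tilt gamma m N) _ J (xi_indep nN)
    (fun=> measurable_tilt _ _ _) (fun=> @tilt_ge0 _ _ _ _)).
    by apply: eq_integral => w _; rewrite prodJ.
  move=> u; have du : has_density (level_var u) (driving_density N gamma).
    by apply: xi_density => //; rewrite (ltn_ord (tag u)).
  (* Any variable of scale [m * N] will do: only its density matters. *)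
  have nmN : (n <= m * N)%N by rewrite (leq_trans nN)// leq_pmull.
  exact: (expectation_tilt gamma_gt1 N0 du m0
    (@xi_density (m * N) 1%N [tuple true | _ < _] nmN n_ge1)).
by rewrite sumEFin sumr_const card_tuple card_bool -[_ *+ _]mulr_natl natrX.
Qed.

Definition tilted_sums_bounded (w : T) : Prop :=
  forall m i, (0 < m)%N -> \forall N \near \oo,
    tilted_sum m i N w <= expR (N%:R / m%:R) *
      (2 ^+ N * (\prod_(j < n | (j < i)%N) m%:R `^ e)).

(** Markov's inequality with a margin of [expR (N / m)] over the mean; the
    margin is exponential in [N], and its rate vanishes as [m] grows. *)
Lemma ae_tilted_sums_bounded : {ae P, forall w, tilted_sums_bounded w}.
Proof.
apply: ae_foralln => m; apply: ae_foralln => i.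
have [m0|] := ltnP 0 m; last first.
  by case: m => // _; apply: aeW.
set c := \prod_(j < n | (j < i)%N) m%:R `^ e.
have c0 : 0 < c by apply: prodr_gt0 => j _; rewrite powR_gt0 ?ltr0n.
have b0 N : 0 < expR (N%:R / m%:R) * (2 ^+ N * c).
  by rewrite mulr_gt0 ?expR_gt0// mulr_gt0// exprn_gt0.
have t0 N w : 0 <= tilted_sum m i N w.
  by apply: sumr_ge0 => s _; apply: prodr_ge0 => j _; exact: tilt_ge0.
have mt N : measurable_fun setT (tilted_sum m i N).
  by apply: measurable_sum => s; exact: measurable_tilted_term.
have : {ae P, forall w, \forall N \near \oo,
    tilted_sum m i N w / (expR (N%:R / m%:R) * (2 ^+ N * c)) <= 1}.
  apply: (@ae_eventually_le1 _ _ _ P _ 1 (expR (- (m%:R)^-1))).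
  - by rewrite expR_ge0/= expR_lt1 oppr_lt0 invr_gt0 ltr0n.
  - by move=> N; apply: measurable_funM.
  - by move=> N w; rewrite divr_ge0// ltW.
  exists n => // N /= nN.
  under eq_integral do rewrite mulrC EFinM.
  rewrite ge0_integralZl//; last 3 first.
  + exact/measurable_EFinP.
  + by move=> w _; rewrite lee_fin.
  + by rewrite lee_fin invr_ge0 ltW.
  rewrite expectation_tilted_sum// -EFinM lee_fin mul1r -/c.
  rewrite le_eqVlt; apply/orP; left; apply/eqP.
  rewrite invfM -mulrA mulVf ?mulr1; last first.
    by rewrite gt_eqF// mulr_gt0// exprn_gt0.
  by rewrite -expRN -expRM_natl mulrN -mulr_natl.
apply: filterS => w [N0 _ h] _; exists N0 => // N /h.
by rewrite ler_pdivrMr// mul1r.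
Qed.

Definition level_count (y : 'I_n -> R) (N : nat) (w : T) : R :=
  path_count (@level_var N) (fun i => `]-oo, (- (N%:R * y i))]%classic) w.

Definition expected_level_count (y : 'I_n -> R) (N : nat) : R :=
  2 ^+ N * \prod_(i < n) lower_tail gamma N (y i).

Lemma lower_tail_gt0 N y : (n <= N)%N -> 0 <= y -> 0 < lower_tail gamma N y.
Proof.
move=> nN y0; have N0 : (0 < N)%N by exact: leq_trans nN.
have dX := @xi_density N 1%N [tuple true | _ < _] nN n_ge1.
have yy' : y < y + 1 by rewrite ltrDl.
apply: lt_le_trans (lower_tail_ge gamma_gt1 N0 dX y0 yy').
rewrite mulr_gt0 ?expR_gt0// mulr_gt0 ?powR_gt0 ?(lt_trans _ gamma_gt1)//.
by rewrite addrC addKr mul1r; exact: normalization_gt0 dX.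
Qed.

Lemma ae_level_count_ge (y : 'I_n -> R) (C rho : R) :
  (forall i, 0 <= y i) -> 0 <= rho < 1 ->
  (\forall N \near \oo, \sum_(i < n) (2 ^+ prefix_len k N i.+1)^-1 *
     \prod_(j < n | (j <= i)%N) (lower_tail gamma N (y j))^-1
     <= C * rho ^+ N) ->
  {ae P, forall w, \forall N \near \oo,
    expected_level_count y N / 2 <= level_count y N w}.
Proof.
move=> y0 rho01 [N0 _ hN].
have : {ae P, forall w, \forall N \near \oo,
    ((level_count y N w - expected_level_count y N) /
     (expected_level_count y N / 2)) ^+ 2 <= 1}.
  apply: (@ae_eventually_le1 _ _ _ P _ (4 * C) rho) => //.
  - move=> N; apply: measurable_funX; apply: measurable_funM => //.
    apply: measurable_funB => //; apply: measurable_sum => s.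
    apply: measurable_indic; exact: measurable_path_event.
  - by move=> N w; rewrite sqr_ge0.
  exists (maxn n N0) => // N /=; rewrite geq_max => /andP[nN N0N].
  have N_gt0 : (0 < N)%N by exact: leq_trans nN.
  apply: le_trans (path_count_variance (pr := fun i => lower_tail gamma N (y i))
    (xi_indep nN) (kN nN) _ _ _) _ => //.
  - by move=> i; exact: lower_tail_gt0.
  - move=> u; apply: (probability_lower_tail _ (N := N)).
    by apply: xi_density => //; rewrite (ltn_ord (tag u)).
  by rewrite lee_fin -mulrA ler_wpM2l//; exact: hN.
apply: filterS => w [N1 _ h]; exists (maxn n N1) => // N /=.
rewrite geq_max => /andP[nN N1N].
have M0 : 0 < expected_level_count y N.
  rewrite mulr_gt0 ?exprn_gt0// prodr_gt0// => i _; exact: lower_tail_gt0.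
have := h N N1N; set t := (X in X ^+ 2 <= 1) => t2.
have t1 : -1 <= t by nra.
by move: t1; rewrite ler_pdivlMr ?divr_gt0//; lra.
Qed.

(** The thresholds are rational so that a single null set serves them all, and
    with them every inverse temperature. The premise says that the expected
    number of initial segments above the thresholds grows exponentially at
    every depth. *)
Definition level_counts_large (w : T) : Prop :=
  forall y : {ffun 'I_n -> rat},
    (forall i, 0 <= ratr (y i) :> R) ->
    (exists C rho : R, 0 <= rho < 1 /\
      \forall N \near \oo, \sum_(i < n) (2 ^+ prefix_len k N i.+1)^-1 *
        \prod_(j < n | (j <= i)%N) (lower_tail gamma N (ratr (y j)))^-1
        <= C * rho ^+ N) ->
    \forall N \near \oo,
      expected_level_count (fun i => ratr (y i)) N / 2 <=
      level_count (fun i => ratr (y i)) N w.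

Lemma ae_level_counts_large : {ae P, forall w, level_counts_large w}.
Proof.
apply: ae_forall_count => y.
have [y0|ny] := pselect (forall i, 0 <= ratr (y i) :> R); last first.
  by apply: aeW => w /ny.
have [[C [rho [rho01 hC]]]|nC] := pselect (exists C rho : R, 0 <= rho < 1 /\
    \forall N \near \oo, \sum_(i < n) (2 ^+ prefix_len k N i.+1)^-1 *
      \prod_(j < n | (j <= i)%N) (lower_tail gamma N (ratr (y j)))^-1
      <= C * rho ^+ N); last by apply: aeW => w _ /nC.
have := ae_level_count_ge y0 rho01 hC.
by apply: filterS => w hw _ _.
Qed.

End AlmostSureEstimates.

(** * Convexity and limits *)

Section Analysis.
Variable R : realType.

Lemma powR_invl (z t : R) : 0 <= z -> z^-1 `^ t = z `^ (- t).
Proof. by move=> z0; rewrite -powR_inv1// -powRrM mulN1r. Qed.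

(** Abel summation: the combination is a nonnegative combination of the partial
    sums, with coefficients the decrements of [c] and its last value. *)
Lemma sum_mul_le_partial (n : nat) (c v d : nat -> R) :
  (forall i, (i < n)%N -> 0 <= c i) ->
  (forall i, (i.+1 < n)%N -> c i.+1 <= c i) ->
  (forall i, (i <= n)%N -> \sum_(j < i) v j <= \sum_(j < i) d j) ->
  \sum_(j < n) c j * v j <= \sum_(j < n) c j * d j.
Proof.
case: n => [|n] c0 cn vd; first by rewrite !big_ord0.
suff : c n * (\sum_(j < n.+1) d j - \sum_(j < n.+1) v j) <=
    \sum_(j < n.+1) c j * d j - \sum_(j < n.+1) c j * v j.
  move=> h; rewrite -subr_ge0; apply: le_trans h.
  by rewrite mulr_ge0 ?c0// subr_ge0 vd.
elim: n c0 cn vd => [|n IH] c0 cn vd; first by rewrite !big_ord1 mulrBr.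
have := IH (fun i h => c0 i (ltnW h)) (fun i h => cn i (ltnW h))
  (fun i h => vd i (leqW h)).
have := vd n.+1 (leqnSn _); have := cn n (ltnSn _).
rewrite ![\sum_(j < n.+2) _]big_ord_recr/=.
move: (\sum_(j < n.+1) v j) (\sum_(j < n.+1) d j) => V D.
move: (\sum_(j < n.+1) c j * v j) (\sum_(j < n.+1) c j * d j) => cV cD.
by nra.
Qed.

Section Conjugate.
Variable gamma : R.
Hypothesis gamma_gt1 : 1 < gamma.
Local Notation q := (gamma / (gamma - 1)).

Lemma young_linear (u z x : R) : 0 < u -> 0 <= z ->
  - (z * x) <= u * (`|x| `^ gamma / gamma) +
    z `^ q * u `^ (- (gamma - 1)^-1) / q.
Proof.
move=> u0 z0.
have g0 : 0 < gamma by exact: lt_trans gamma_gt1.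
have g1 : 0 < gamma - 1 by rewrite subr_gt0.
have q0 : 0 < q by rewrite divr_gt0.
pose r := u `^ gamma^-1.
have r0 : 0 < r by rewrite powR_gt0.
apply: (@le_trans _ _ ((`|x| * r) * (z / r))).
  rewrite (_ : _ * (z / r) = z * `|x|); last by field; rewrite gt_eqF.
  by rewrite -mulrN ler_wpM2l// -normrN ler_norm.
apply: le_trans (conjugate_powR _ _ g0 q0 _) _.
- by rewrite mulr_ge0 ?normr_ge0 ?(ltW r0).
- by rewrite divr_ge0 ?(ltW r0).
- by field; rewrite !gt_eqF.
rewrite (powRM _ (normr_ge0 x) (ltW r0)).
have ri : 0 <= r^-1 by rewrite invr_ge0 ltW.
rewrite (powRM _ z0 ri).
have -> : r `^ gamma = u.
  by rewrite /r -powRrM mulVf ?powRr1 ?gt_eqF// ltW.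
have -> : r^-1 `^ q = u `^ (- (gamma - 1)^-1).
  rewrite -powR_inv1 ?(ltW r0)// /r -!powRrM; congr (_ `^ _).
  by field; rewrite !gt_eqF.
by rewrite le_eqVlt; apply/orP; left; apply/eqP; ring.
Qed.

Lemma powR_conjugate (t : R) : 0 < t -> t `^ q = t * t `^ (gamma - 1)^-1.
Proof.
move=> t0; rewrite (_ : q = 1 + (gamma - 1)^-1); last first.
  by field; rewrite gt_eqF// subr_gt0.
by rewrite powRD ?powRr1 ?(ltW t0)// (gt_eqF t0) implybT.
Qed.

(** Young's inequality at the scale of the driving variables. The free slope in
    front of the exponent of the weight is set to [beta / b]: at [th = 1] this
    gives equality when [x = - N * (b * a) ^ (1 / (gamma - 1))]. *)
Lemma young_tilted (N : nat) (beta b a th x : R) : (0 < N)%N ->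
  0 < beta -> 0 < b -> 0 < a -> 0 < th ->
  - (beta * (a * x)) <=
    beta / b * (th * (`|x| `^ gamma / (gamma * N%:R `^ (gamma - 1)))) +
    N%:R * (th `^ (- (gamma - 1)^-1) *
            (beta * b `^ (gamma - 1)^-1 * a `^ q / q)).
Proof.
move=> N0 beta0 b0 a0 th0.
have g0 : 0 < gamma by exact: lt_trans gamma_gt1.
have g1 : 0 < gamma - 1 by rewrite subr_gt0.
have NR : 0 < N%:R :> R by rewrite ltr0n.
have Np : 0 < N%:R `^ (gamma - 1) by rewrite powR_gt0.
have u0 : 0 < beta / b * th / N%:R `^ (gamma - 1).
  by rewrite divr_gt0// mulr_gt0// divr_gt0.
rewrite mulrA; apply: le_trans (young_linear x u0 _) _.
  by rewrite mulr_ge0 ?ltW.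
rewrite le_eqVlt; apply/orP; left; apply/eqP; congr (_ + _).
  by field; rewrite !gt_eqF.
rewrite powRM ?(ltW beta0) ?(ltW a0)//.
rewrite [X in _ * X / _]powRM ?invr_ge0 ?powR_ge0 ?mulr_ge0 ?invr_ge0 ?ltW//.
rewrite [X in _ * (X * _) / _]powRM ?mulr_ge0 ?invr_ge0 ?ltW//.
rewrite [X in _ * (X * _ * _) / _]powRM ?invr_ge0 ?ltW//.
rewrite !powR_invl ?powR_ge0 ?(ltW b0)// !opprK -powRrM.
rewrite (_ : (gamma - 1) * (gamma - 1)^-1 = 1); last by rewrite divff// gt_eqF.
rewrite powRr1 ?(ltW NR)//.
rewrite (powR_conjugate beta0) powRN.
have := powR_gt0 (gamma - 1)^-1 beta0; move: (beta `^ _) => B B0.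
move: (a `^ _) (b `^ _) (th `^ _) => A D t.
by field; rewrite !gt_eqF.
Qed.

End Conjugate.
End Analysis.

Section Limits.
Variable R : realType.

Lemma cvg_sum_ord (n : nat) (T : Type) (F : set_system T)
    (f : 'I_n -> T -> R) (l : 'I_n -> R) : Filter F ->
  (forall i, f i x @[x --> F] --> l i) ->
  (\sum_(i < n) f i x) @[x --> F] --> \sum_(i < n) l i.
Proof.
by move=> FF fl; apply: cvg_big => //; exact: add_continuous.
Qed.

Lemma near_forall_le (Q : nat -> nat -> Prop) n :
  (forall i, (i <= n)%N -> \forall N \near \oo, Q i N) ->
  \forall N \near \oo, forall i, (i <= n)%N -> Q i N.
Proof.
elim: n => [|n IH] h.
  by have := h 0%N (leqnn _); apply: filterS => N Q0 [|//].
have h1 := IH (fun i ile => h i (leqW ile)).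
have h2 := h n.+1 (leqnn _).
near=> N => i; rewrite leq_eqVlt => /predU1P[->|ile].
  by near: N.
by move: i ile; near: N.
Unshelve. all: by end_near. Qed.

(** The loss incurred by the weights disappears as [m] grows. *)
Lemma cvg_tilt_ratio (gamma c : R) : 1 < gamma ->
  (1 - (m.+1%:R `^ (gamma - 1))^-1) `^ c @[m --> \oo] --> (1 : R).
Proof.
move=> g1.
have c1 : {for 1, continuous (fun t : R => t `^ c)}.
  apply: differentiable_continuous; apply/derivable1_diffP.
  by apply: derivable_powR; rewrite in_itv/= ltr01.
have h0 : (m.+1%:R `^ (gamma - 1))^-1 @[m --> \oo] --> (0 : R).
  have hp : (m.+1%:R : R)^-1 @[m --> \oo] --> 0^'+.
    move=> A [e /= e0 eA].
    have /cvgr0Pnorm_lt/(_ _ e0)[N _ hN] := @cvg_harmonic R.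
    exists N => // m /hN/= hm; apply: eA => //=.
    by have := hm; rewrite sub0r normrN.
  have g0 : 0 < gamma - 1 by rewrite subr_gt0.
  have := cvg_comp _ _ hp (powR_cvg0 g0).
  apply: cvg_trans; apply: near_eq_cvg; apply: nearW => m /=.
  by rewrite powR_invl// powRN.
have h1 : 1 - (m.+1%:R `^ (gamma - 1))^-1 @[m --> \oo] --> (1 : R).
  by rewrite -[X in _ --> X]subr0; apply: cvgB => //; exact: cvg_cst.
by have := cvg_comp _ _ h1 c1; rewrite powR1.
Qed.

End Limits.

(** * Upper bound *)

Section UpperBound.
Context d (T : measurableType d) (R : realType) (P : probability T R).
Variables (k : nat -> nat -> nat) (n : nat) (gamma : R).
Variable xi : forall N i : nat, (prefix_len k N i).-tuple bool -> {RV P >-> R}.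
Arguments xi : clear implicits.
Variables (a b : nat -> R) (beta : R).
Hypothesis n_ge1 : (1 <= n)%N.
Hypothesis gamma_gt1 : 1 < gamma.
Hypothesis k_sum : forall N, (n <= N)%N -> (\sum_(1 <= i < n.+1) k i N)%N = N.
Hypothesis a_gt0 : forall i, (1 <= i <= n)%N -> 0 < a i.
Hypothesis beta_gt0 : 0 < beta.
Hypothesis b_gt0 : forall i, (1 <= i <= n)%N -> 0 < b i.
Hypothesis b_le : forall i, (1 <= i <= n)%N -> b i <= beta.
Hypothesis b_mono : forall i, (1 <= i < n)%N -> b i <= b i.+1.

Local Notation q := (gamma / (gamma - 1)).

Lemma prefix_len_ord N i :
  (prefix_len k N i = \sum_(j < i) k j.+1 N)%N.
Proof. by rewrite /prefix_len big_add1/= big_mkord. Qed.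

Lemma prefix_len_total N : (n <= N)%N -> prefix_len k N n = N.
Proof. exact: k_sum. Qed.

Lemma prefix_len_leN N i : (n <= N)%N -> (i <= n)%N ->
  (prefix_len k N i <= N)%N.
Proof.
by move=> nN ile; rewrite -[leqRHS](prefix_len_total nN) prefix_len_mono.
Qed.

Let tilt_exponent m N (s : N.-tuple bool) (w : T) (i : nat) : R :=
  (1 - (m%:R `^ (gamma - 1))^-1) *
  (`|xi N i.+1 (spin_prefix k i.+1 s) w| `^ gamma /
    (gamma * N%:R `^ (gamma - 1))).

Let tilted_sumE m i N w : (i <= n)%N ->
  tilted_sum n gamma xi m i N w =
  \sum_(s : N.-tuple bool) expR (\sum_(j < i) tilt_exponent m s w j).
Proof.
move=> ile; apply: eq_bigr => s _; rewrite expR_sum.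
by rewrite (big_ord_widen n (fun j => expR (tilt_exponent m s w j)) ile).
Qed.

(** The weight of the first [i] levels of [s] occurs in [tilted_sum] once for
    every continuation, that is, [2 ^ (N - K)] times if these levels have length
    [K]. *)
Lemma path_weight_le m N w D (s : N.-tuple bool) i : (n <= N)%N ->
  (i <= n)%N -> tilted_sum n gamma xi m i N w <= expR D * 2 ^+ N ->
  \sum_(j < i) tilt_exponent m s w j <= (prefix_len k N i)%:R * ln 2 + D.
Proof.
move=> nN ile tD; have KN := prefix_len_leN nN ile.
set V := \sum_(j < i) _.
have h : (2 ^ (N - prefix_len k N i))%:R * expR V <= expR D * 2 ^+ N.
  apply: le_trans tD; rewrite tilted_sumE// -(card_same_prefix s KN).
  rewrite mulr_natl -sumr_const.
  rewrite [leRHS](bigID (fun t => t \in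
    [set t : N.-tuple bool | spin_prefix k i t == spin_prefix k i s]%SET))/=.
  rewrite -[leLHS]addr0; apply: lerD; last first.
    by apply: sumr_ge0 => t _; exact: expR_ge0.
  apply: ler_sum => t; rewrite inE => /eqP ts.
  rewrite ler_expR le_eqVlt; apply/orP; left; apply/eqP.
  apply: eq_bigr => j _; rewrite /tilt_exponent.
  have -> // : spin_prefix k j.+1 t = spin_prefix k j.+1 s.
  by apply: spin_prefix_mono ts.
rewrite -ler_expR expRD expRM_natl lnK ?posrE//.
rewrite natrX mulrC -ler_pdivlMr ?exprn_gt0// in h.
apply: le_trans h _; rewrite -mulrA mulrC ler_wpM2r ?expR_ge0//.
rewrite ler_pdivrMr ?exprn_gt0// -exprD subnKC//.
Qed.

Let S := \sum_(i < n) beta * b i.+1 `^ (gamma - 1)^-1 * a i.+1 `^ q / q.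

(** Young's inequality replaces the energy of a level by [beta / b] times the
    exponent of its weight. Since [beta / b] decreases with the level, the
    excess [beta / b - 1] is controlled by the constraints of [path_weight_le]
    through Abel summation; one copy of each exponent is left, and these sum to
    [tilted_sum] at full depth. *)
Lemma partition_function_le m N w D : (1 < m)%N -> (n <= N)%N -> 0 <= D ->
  (forall i, (i <= n)%N ->
     tilted_sum n gamma xi m i N w <= expR D * 2 ^+ N) ->
  ln (partition_function n a xi N beta w) <=
  N%:R * ((1 - (m%:R `^ (gamma - 1))^-1) `^ (- (gamma - 1)^-1) * S) +
  \sum_(i < n) (beta / b i.+1 - 1) * ((k i.+1 N)%:R * ln 2 + D) +
  (D + N%:R * ln 2).
Proof.
move=> m1 nN D0 tD.
have N0 : (0 < N)%N by exact: leq_trans nN.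
set th := 1 - _.
have th0 : 0 < th.
  rewrite subr_gt0 invf_lt1 ?powR_gt0 ?ltr0n ?(ltnW m1)//.
  have : 1 `^ (gamma - 1) < m%:R `^ (gamma - 1).
    by apply: gt0_ltr_powR; rewrite ?subr_gt0 ?nnegrE ?ler0n ?ltr1n.
  by rewrite powR1.
set E1 := N%:R * _; set E2 := \sum_(i < n) _.
suff h : partition_function n a xi N beta w <=
    expR (E1 + E2 + (D + N%:R * ln 2)).
  have Z0 : 0 < partition_function n a xi N beta w.
    rewrite /partition_function (bigD1 [tuple true | _ < N])//=.
    by rewrite ltr_pwDl ?expR_gt0// sumr_ge0// => s _; exact: expR_ge0.
  by rewrite -[leRHS]expRK ler_ln// posrE expR_gt0.
apply: (@le_trans _ _ (\sum_(s : N.-tuple bool)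
    expR (E1 + E2) * expR (\sum_(j < n) tilt_exponent m s w j))); last first.
  rewrite -mulr_sumr -tilted_sumE// [leRHS]expRD ler_wpM2l ?expR_ge0//.
  apply: le_trans (tD n (leqnn _)) _.
  by rewrite expRD expRM_natl lnK ?posrE.
apply: ler_sum => s _; rewrite -expRD ler_expR.
rewrite /hamiltonian big_add1/= big_mkord mulNr mulr_sumr -sumrN.
apply: (@le_trans _ _ (\sum_(i < n) (beta / b i.+1 * tilt_exponent m s w i +
   N%:R * (th `^ (- (gamma - 1)^-1) *
            (beta * b i.+1 `^ (gamma - 1)^-1 * a i.+1 `^ q / q))))).
  apply: ler_sum => i _; apply: young_tilted => //.
    by rewrite b_gt0//=.
  by rewrite a_gt0//=.
rewrite big_split/=.
have -> : \sum_(i < n) N%:R * (th `^ (- (gamma - 1)^-1) *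
    (beta * b i.+1 `^ (gamma - 1)^-1 * a i.+1 `^ q / q)) = E1.
  by rewrite -!mulr_sumr.
rewrite [leLHS]addrC -[leRHS]addrA lerD2l.
rewrite -lerBlDr -sumrB.
rewrite (eq_bigr (fun i : 'I_n =>
  (beta / b i.+1 - 1) * tilt_exponent m s w i)); last first.
  by move=> i _; ring.
apply: (@sum_mul_le_partial _ n (fun i => beta / b i.+1 - 1)
  (tilt_exponent m s w) (fun i => (k i.+1 N)%:R * ln 2 + D)).
- by move=> i ilt; rewrite subr_ge0 ler_pdivlMr ?b_gt0// mul1r b_le.
- move=> i ilt; rewrite lerD2r ler_pM2l// lef_pV2 ?posrE ?b_gt0 ?b_mono//.
  exact: ltnW.
move=> [_|i ile]; first by rewrite !big_ord0.
apply: le_trans (path_weight_le s nN ile (tD _ ile)) _.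
rewrite big_split/= -mulr_suml -natr_sum -prefix_len_ord lerD2l.
by rewrite sumr_const card_ord mulrS lerDl mulrn_wge0.
Qed.

End UpperBound.

Section UpperLimit.
Context d (T : measurableType d) (R : realType) (P : probability T R).
Variables (k : nat -> nat -> nat) (n : nat) (gamma : R).
Variable xi : forall N i : nat, (prefix_len k N i).-tuple bool -> {RV P >-> R}.
Arguments xi : clear implicits.
Variables (a b p : nat -> R) (beta : R) (w : T).
Hypothesis n_ge1 : (1 <= n)%N.
Hypothesis gamma_gt1 : 1 < gamma.
Hypothesis k_sum : forall N, (n <= N)%N -> (\sum_(1 <= i < n.+1) k i N)%N = N.
Hypothesis k_lim : forall i, (1 <= i <= n)%N ->
  (k i N)%:R / N%:R @[N --> \oo] --> p i.
Hypothesis a_gt0 : forall i, (1 <= i <= n)%N -> 0 < a i.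
Hypothesis beta_gt0 : 0 < beta.
Hypothesis b_gt0 : forall i, (1 <= i <= n)%N -> 0 < b i.
Hypothesis b_le : forall i, (1 <= i <= n)%N -> b i <= beta.
Hypothesis b_mono : forall i, (1 <= i < n)%N -> b i <= b i.+1.
Hypothesis tilted_w : tilted_sums_bounded n gamma xi w.

Local Notation q := (gamma / (gamma - 1)).
Let S := \sum_(i < n) beta * b i.+1 `^ (gamma - 1)^-1 * a i.+1 `^ q / q.

(** Here [N] tends to infinity first, for a fixed [m] so large that the losses
    due to the weights are below [eps / 2]. *)
Lemma free_energy_le (eps : R) : 0 < eps -> \forall N \near \oo,
  N%:R^-1 * ln (partition_function n a xi N beta w) <=
  S + \sum_(i < n) (beta / b i.+1 - 1) * (p i.+1 * ln 2) + ln 2 + eps.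
Proof.
move=> eps0; set L := S + _ + _.
pose G m := (1 - (m%:R `^ (gamma - 1))^-1) `^ (- (gamma - 1)^-1) * S +
  \sum_(i < n) (beta / b i.+1 - 1) * (p i.+1 * ln 2 + m%:R^-1) +
  (m%:R^-1 + ln 2).
have GL : G m.+1 @[m --> \oo] --> L.
  have h0 : (m.+1%:R : R)^-1 @[m --> \oo] --> (0 : R) by exact: cvg_harmonic.
  rewrite (_ : L = 1 * S + \sum_(i < n) (beta / b i.+1 - 1) * (p i.+1 * ln 2) +
    (0 + ln 2)); last by rewrite mul1r add0r.
  apply: cvgD; first apply: cvgD.
  - by apply: cvgM; [exact: cvg_tilt_ratio|exact: cvg_cst].
  - apply: cvg_sum_ord => i; apply: cvgM; first exact: cvg_cst.
    have h3 : p i.+1 * ln 2 + m.+1%:R^-1 @[m --> \oo] --> p i.+1 * ln 2 + 0.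
      by apply: cvgD; [exact: cvg_cst|exact: h0].
    by rewrite addr0 in h3.
  - by apply: cvgD => //; exact: cvg_cst.
have [m m1 Gm] : exists2 m, (1 < m)%N & G m < L + eps / 2.
  have /cvgrPdist_lt/(_ (eps / 2)) := GL; rewrite divr_gt0// => /(_ isT).
  case=> m0 _ /(_ m0.+1 (leqnSn _))/= h; exists m0.+2 => //.
  by move: h; rewrite ltr_distlC => /andP[]; lra.
have m0 : (0 < m)%N by exact: ltnW.
have mR : 0 < m%:R :> R by rewrite ltr0n.
(* [expR (D N)] bounds the margin [expR (N / m)] times the product of the means
   of the weights, each at most [m]. *)
pose D N := N%:R / m%:R + n%:R * ln m%:R : R.
have lnm : 0 <= ln m%:R :> R by rewrite ln_ge0// ler1n.
pose F N := (1 - (m%:R `^ (gamma - 1))^-1) `^ (- (gamma - 1)^-1) * S +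
  \sum_(i < n) (beta / b i.+1 - 1) *
    ((k i.+1 N)%:R / N%:R * ln 2 + (m%:R^-1 + n%:R * ln m%:R / N%:R)) +
  (m%:R^-1 + n%:R * ln m%:R / N%:R + ln 2).
have FG : F N @[N --> \oo] --> G m.
  have h1 : m%:R^-1 + n%:R * ln m%:R / N%:R @[N --> \oo] --> (m%:R^-1 : R).
    have h2 : (N%:R : R)^-1 @[N --> \oo] --> (0 : R).
      by rewrite -cvg_shiftS; exact: cvg_harmonic.
    have h3 : m%:R^-1 + n%:R * ln m%:R / N%:R @[N --> \oo] -->
        (m%:R^-1 + n%:R * ln m%:R * 0 : R).
      apply: cvgD; first exact: cvg_cst.
      by apply: cvgM; [exact: cvg_cst|exact: h2].
    by rewrite mulr0 addr0 in h3.
  apply: cvgD; first apply: cvgD; first exact: cvg_cst.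
  - apply: cvg_sum_ord => i; apply: cvgM; first exact: cvg_cst.
    apply: cvgD => //; apply: cvgM; last exact: cvg_cst.
    by apply: k_lim; rewrite /= ltn_ord.
  - by apply: cvgD => //; exact: cvg_cst.
have tn := near_forall_le (n := n) (fun i _ => tilted_w i m0).
near=> N.
have nN : (n <= N)%N by near: N; exact: nbhs_infty_ge.
have N0 : (0 < N)%N by exact: leq_trans nN.
have NR : 0 < N%:R :> R by rewrite ltr0n.
have FN : F N <= L + eps.
  have : `|G m - F N| < eps / 2.
    by near: N; move/cvgrPdist_lt : FG; apply; rewrite divr_gt0.
  by rewrite ltr_distlC => /andP[] ; lra.
apply: le_trans FN; rewrite mulrC ler_pdivrMr//.
have D0 : 0 <= D N by rewrite addr_ge0 ?mulr_ge0 ?invr_ge0.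
apply: le_trans (partition_function_le (D := D N) n_ge1 gamma_gt1 k_sum
  a_gt0 beta_gt0 b_gt0 b_le b_mono m1 nN D0 _) _.
  move=> i ile.
  have tN : forall i, (i <= n)%N -> tilted_sum n gamma xi m i N w <=
    expR (N%:R / m%:R) *
    (2 ^+ N * (\prod_(j < n | (j < i)%N) m%:R `^ ((gamma - 1) / gamma))).
    by near: N.
  apply: le_trans (tN i ile) _.
  rewrite /D expRD -mulrA ler_wpM2l ?expR_ge0// mulrC ler_wpM2r ?exprn_ge0//.
  rewrite expRM_natl lnK ?posrE// big_mkcond/=.
  rewrite -[leRHS](_ : \prod_(j < n) m%:R = _); last first.
    by rewrite prodr_const card_ord.
  apply: ler_prod => j _; case: ifP => _; last by rewrite ler01 ler1n.
  rewrite powR_ge0 ler1_powR ?ler1n//.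
  have g0 : 0 < gamma by exact: lt_trans gamma_gt1.
  by rewrite ler_pdivrMr// mul1r gerBl.
rewrite -/S /F [leRHS]mulrDl [X in _ <= X + _]mulrDl.
rewrite le_eqVlt; apply/orP; left; apply/eqP; congr (_ + _ + _).
- by ring.
- rewrite mulr_suml; apply: eq_bigr => i _; rewrite /D; field.
  by rewrite !gt_eqF// b_gt0//= ltn_ord.
- by rewrite /D; field; rewrite !gt_eqF.
Unshelve. all: by end_near. Qed.

End UpperLimit.

(** * Lower bound *)

Section LowerBound.
Context d (T : measurableType d) (R : realType) (P : probability T R).
Variables (k : nat -> nat -> nat) (n : nat) (gamma : R).
Variable xi : forall N i : nat, (prefix_len k N i).-tuple bool -> {RV P >-> R}.
Arguments xi : clear implicits.
Variables (a p x : nat -> R) (beta : R) (w : T).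
Hypothesis n_ge1 : (1 <= n)%N.
Hypothesis gamma_gt1 : 1 < gamma.
Hypothesis k_lim : forall i, (1 <= i <= n)%N ->
  (k i N)%:R / N%:R @[N --> \oo] --> p i.
Hypothesis p_ge0 : forall i, (1 <= i <= n)%N -> 0 <= p i.
Hypothesis p1_gt0 : 0 < p 1%N.
Hypothesis a_gt0 : forall i, (1 <= i <= n)%N -> 0 < a i.
Hypothesis beta_gt0 : 0 < beta.
Hypothesis xi_density : forall N i (s : (prefix_len k N i).-tuple bool),
  (n <= N)%N -> (1 <= i <= n)%N ->
  has_density (xi N i s) (driving_density N gamma).
Hypothesis x_gt0 : forall i, (1 <= i <= n)%N -> 0 < x i.
Hypothesis x_feasible : forall i, (i <= n)%N ->
  \sum_(j < i) x j.+1 `^ gamma / gamma <= \sum_(j < i) p j.+1 * ln 2.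

Lemma partition_function_ge (y : 'I_n -> R) N : (n <= N)%N ->
  level_count xi y N w * expR (N%:R * (beta * \sum_(i < n) a i.+1 * y i)) <=
  partition_function n a xi N beta w.
Proof.
move=> nN; rewrite /level_count /path_count /partition_function mulr_suml.
apply: ler_sum => s _; rewrite indicE.
case: (boolP (w \in _)) => [|_]; last by rewrite mul0r expR_ge0.
move=> /set_mem sw; rewrite mul1r ler_expR /hamiltonian big_add1/= big_mkord.
rewrite mulrCA mulNr -mulrN ler_wpM2l ?(ltW beta_gt0)// mulr_sumr -sumrN.
apply: ler_sum => i _; rewrite mulrCA -mulrN ler_wpM2l//.
  by rewrite ltW// a_gt0/=.
have := sw (prefix_at k s i); rewrite /= imset_f// => /(_ isT).
by rewrite in_itv/= lerNr.
Qed.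

Local Notation e := ((gamma - 1) / gamma).
Let C0 : R := (2 * Gamma gamma^-1)^-1 * gamma `^ e.

Let C0_gt0 : 0 < C0.
Proof.
have g0 : 0 < gamma by exact: lt_trans gamma_gt1.
rewrite mulr_gt0 ?powR_gt0//.
exact: normalization_gt0
  (@xi_density n 1%N [tuple true | _ < _] (leqnn n) n_ge1).
Qed.

Lemma lower_tail_exp_le (y y' : R) N : (n <= N)%N -> 0 <= y -> y < y' ->
  (y' - y) * C0 * expR (- (N%:R * (y' `^ gamma / gamma))) <=
  lower_tail gamma N y.
Proof.
move=> nN y0 yy'; have N0 : (0 < N)%N by exact: leq_trans nN.
have := lower_tail_ge gamma_gt1 N0
  (@xi_density N 1%N [tuple true | _ < _] nN n_ge1) y0 yy'.
by rewrite /C0 !mulrA.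
Qed.

Hypothesis count_w : level_counts_large n gamma xi w.

(** Shrinking the [x i] leaves a positive entropy at every depth, uniformly:
    the first level alone provides it. *)
Lemma scaled_feasible (s : R) i : 0 < s < 1 -> (0 < i <= n)%N ->
  \sum_(j < i) (s * x j.+1) `^ gamma / gamma + (1 - s `^ gamma) * (p 1%N * ln 2)
  <= \sum_(j < i) p j.+1 * ln 2.
Proof.
move=> /andP[s0 s1] /andP[i0 ile].
have g0 : 0 < gamma by exact: lt_trans gamma_gt1.
have -> : \sum_(j < i) (s * x j.+1) `^ gamma / gamma =
    s `^ gamma * \sum_(j < i) x j.+1 `^ gamma / gamma.
  rewrite mulr_sumr; apply: eq_bigr => j _.
  have ji : (j < n)%N by exact: leq_trans (ltn_ord j) ile.
  by rewrite powRM ?(ltW s0) ?(ltW (x_gt0 _))// mulrA.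
have sg1 : s `^ gamma <= 1.
  by apply: le_trans (ge1r_powR _ (ltW gamma_gt1)) (ltW s1); rewrite s0 ltW.
have h := x_feasible ile.
have hp : p 1%N * ln 2 <= \sum_(j < i) p j.+1 * ln 2.
  case: i i0 ile h => // i _ ile _.
  rewrite big_ord_recl/= lerDl sumr_ge0// => j _.
  rewrite mulr_ge0 ?ln_ge0 ?ler1n// p_ge0//=.
  by apply: leq_trans ile; rewrite /bump/= add1n ltnS; exact: ltn_ord.
have s0g : 0 <= s `^ gamma by exact: powR_ge0.
rewrite -subr_ge0 in h; rewrite -subr_ge0 in hp; rewrite -subr_ge0 in sg1.
have h1 := mulr_ge0 s0g h; have h2 := mulr_ge0 sg1 hp.
by lra.
Qed.

Lemma near_prefix_len (eta : R) : 0 < eta -> \forall N \near \oo,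
  forall i, (i <= n)%N -> N%:R * (\sum_(j < i) p j.+1 * ln 2 - eta) <=
    (prefix_len k N i)%:R * ln 2.
Proof.
move=> eta0; apply: near_forall_le => i ile.
have h : \sum_(j < i) (k j.+1 N)%:R / N%:R * ln 2 @[N --> \oo] -->
    \sum_(j < i) p j.+1 * ln 2.
  apply: cvg_sum_ord => j; apply: cvgM; last exact: cvg_cst.
  by apply: k_lim; rewrite /= (leq_trans (ltn_ord j)).
near=> N.
have N0 : (0 < N)%N by near: N; exact: nbhs_infty_gt.
have NR : 0 < N%:R :> R by rewrite ltr0n.
have : `|\sum_(j < i) p j.+1 * ln 2 -
    \sum_(j < i) (k j.+1 N)%:R / N%:R * ln 2| < eta.
  by near: N; move/cvgrPdist_lt : h; apply.
rewrite ltr_distlC => /andP[/ltW h1 _].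
rewrite mulrC -ler_pdivlMr//; apply: le_trans h1 _.
rewrite prefix_len_ord natr_sum !mulr_suml le_eqVlt; apply/orP; left.
by apply/eqP; apply: eq_bigr => j _; rewrite mulrAC.
Unshelve. all: by end_near. Qed.

(** With an entropy of at least [eta] at every depth, the expected number of
    admissible initial segments grows at least like [exp (N * eta / 2)]; half
    of [eta] pays for the fluctuations of the proportions [k i N / N]. *)
Lemma separation_cost_le (y y' : 'I_n -> R) (eta : R) : 0 < eta ->
  (forall i, 0 <= y i < y' i) ->
  (forall i, (0 < i <= n)%N ->
    \sum_(j < n | (j < i)%N) y' j `^ gamma / gamma + eta <=
    \sum_(j < i) p j.+1 * ln 2) ->
  \forall N \near \oo, \sum_(i < n) (2 ^+ prefix_len k N i.+1)^-1 *
      \prod_(j < n | (j <= i)%N) (lower_tail gamma N (y j))^-1 <=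
  (\sum_(i < n) \prod_(j < n | (j <= i)%N) ((y' j - y j) * C0)^-1) *
    expR (- (eta / 2)) ^+ N.
Proof.
move=> eta0 yy' feas.
have eta20 : 0 < eta / 2 by rewrite divr_gt0.
have hK := near_prefix_len eta20.
near=> N.
have nN : (n <= N)%N by near: N; exact: nbhs_infty_ge.
have hN : forall i, (i <= n)%N ->
    N%:R * (\sum_(j < i) p j.+1 * ln 2 - eta / 2) <=
    (prefix_len k N i)%:R * ln 2 by near: N.
rewrite mulr_suml; apply: ler_sum => i _.
have c0 (j : 'I_n) : 0 < (y' j - y j) * C0.
  by rewrite mulr_gt0// subr_gt0; case/andP: (yy' j).
apply: (@le_trans _ _ ((2 ^+ prefix_len k N i.+1)^-1 *
  \prod_(j < n | (j <= i)%N) (((y' j - y j) * C0)^-1 *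
     expR (N%:R * (y' j `^ gamma / gamma))))).
  rewrite ler_wpM2l ?invr_ge0 ?exprn_ge0//; apply: ler_prod => j _.
  have /andP[y0 lyy'] := yy' j.
  rewrite invr_ge0 ltW ?(lt_le_trans _ (lower_tail_exp_le nN y0 lyy'))//=.
    rewrite -[X in _ <= _ * X]invrK -expRN -invfM lef_pV2 ?posrE.
    - exact: lower_tail_exp_le.
    - rewrite (lt_le_trans _ (lower_tail_exp_le nN y0 lyy'))//.
      by rewrite mulr_gt0 ?expR_gt0.
    - by rewrite mulr_gt0 ?expR_gt0.
  by rewrite mulr_gt0 ?expR_gt0.
rewrite big_split/= mulrCA ler_wpM2l//.
  by apply: prodr_ge0 => j _; rewrite invr_ge0 ltW.
rewrite -expR_sum -mulr_sumr.
set K := prefix_len k N i.+1.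
have -> : (2 ^+ K)^-1 = expR (- (K%:R * ln 2)) :> R.
  by rewrite expRN expRM_natl lnK ?posrE.
rewrite -expRD -expRM_natl ler_expR.
have := hN i.+1 (ltn_ord i); have := feas i.+1 (ltn_ord i).
rewrite (eq_bigl (fun j : 'I_n => (j <= i)%N))//.
set Y := \sum_(j < n | _) _; set Q := \sum_(j < i.+1) _ => YQ hK'.
have NR : 0 <= N%:R :> R by [].
have YQ' : 0 <= Q - eta - Y by lra.
have := mulr_ge0 NR YQ'; lra.
Unshelve. all: by end_near. Qed.

(** The [x i] are shrunk by a factor [s] close to [1] to make them
    strictly feasible, and then lowered to rational thresholds above
    [s ^+ 2 * x]. *)
Lemma free_energy_ge (eps : R) : 0 < eps -> \forall N \near \oo,
  ln 2 + \sum_(i < n) (beta * (a i.+1 * x i.+1) - x i.+1 `^ gamma / gamma)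
    - eps <=
  N%:R^-1 * ln (partition_function n a xi N beta w).
Proof.
move=> eps0.
have g0 : 0 < gamma by exact: lt_trans gamma_gt1.
pose A := beta * \sum_(i < n) a i.+1 * x i.+1.
have A0 : 0 <= A.
  rewrite mulr_ge0 ?(ltW beta_gt0)// sumr_ge0// => i _.
  by rewrite mulr_ge0 ?ltW ?a_gt0 ?x_gt0//=.
have [s s01 sA] : exists2 s : R, 0 < s < 1 & A - eps / 2 <= s ^+ 2 * A.
  (* [s = 1 - dl] loses at most [2 * dl * A], which is at most [eps / 2]. *)
  pose dl := Num.min 2^-1 (eps / (4 * (A + 1))).
  have A1 : 0 < 4 * (A + 1) by lra.
  have d0 : 0 < dl by rewrite lt_min invr_gt0 ltr0n/= divr_gt0.
  have d1 : dl <= 2^-1 by rewrite ge_min lexx.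
  have d2 : dl * (4 * (A + 1)) <= eps.
    by rewrite -ler_pdivlMr// ge_min lexx orbT.
  exists (1 - dl); first by apply/andP; split; lra.
  by nra.
have /andP[s0 s1] := s01.
have ss : s ^+ 2 < s by rewrite expr2 gtr_pMl.
have [yr hyr] : {yr : 'I_n -> rat &
    forall i : 'I_n, s ^+ 2 * x i.+1 < ratr (yr i) < s * x i.+1}.
  apply: (@boolp.choice 'I_n rat
    (fun i r => s ^+ 2 * x i.+1 < ratr r < s * x i.+1)) => i.
  have sx : s ^+ 2 * x i.+1 < s * x i.+1 by rewrite ltr_pM2r ?x_gt0//=.
  by have [r] := rat_in_itvoo sx; rewrite in_itv/= => h; exists r.
pose y : {ffun 'I_n -> rat} := [ffun i => yr i].
have hy (i : 'I_n) : s ^+ 2 * x i.+1 < ratr (y i) < s * x i.+1.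
  by rewrite ffunE.
have y0 (i : 'I_n) : 0 <= ratr (y i) :> R.
  case/andP: (hy i) => /ltW h _; apply: le_trans h.
  by rewrite mulr_ge0 ?sqr_ge0// ltW// x_gt0/=.
pose y' (i : 'I_n) : R := s * x i.+1.
have yy' i : 0 <= (ratr (y i) : R) < y' i.
  by rewrite y0/=; case/andP: (hy i).
pose eta := (1 - s `^ gamma) * (p 1%N * ln 2).
have eta0 : 0 < eta.
  rewrite mulr_gt0//; last by rewrite mulr_gt0// ln_gt0// ltr1n.
  rewrite subr_gt0 -[X in _ < X](_ : 1 `^ gamma = 1) ?powR1//.
  have := @gt0_ltr_powR R gamma g0 s 1; rewrite powR1.
  by apply; rewrite ?nnegrE ?ltW.
have feas i : (0 < i <= n)%N ->
    \sum_(j < n | (j < i)%N) y' j `^ gamma / gamma + eta <=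
    \sum_(j < i) p j.+1 * ln 2.
  move=> i0; have := scaled_feasible s01 i0.
  by rewrite (big_ord_widen n (fun j => (s * x j.+1) `^ gamma / gamma))//;
    case/andP: i0.
(* The prefactors of the tail bounds do not depend on [N]. *)
pose kappa := \prod_(i < n) ((y' i - ratr (y i)) * C0).
have kappa0 : 0 < kappa.
  by apply: prodr_gt0 => i _; rewrite mulr_gt0// subr_gt0; case/andP: (yy' i).
have hcount : \forall N \near \oo,
    expected_level_count gamma (fun i => ratr (y i)) N / 2 <=
    level_count xi (fun i => ratr (y i)) N w.
  apply: count_w => //.
  exists (\sum_(i < n)
    \prod_(j < n | (j <= i)%N) ((y' j - ratr (y j)) * C0)^-1).
  exists (expR (- (eta / 2))); split; last exact: separation_cost_le.
  by rewrite expR_ge0 expR_lt1 oppr_lt0 divr_gt0.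
have hlog : \forall N \near \oo, `|ln (kappa / 2) / N%:R| < eps / 2.
  have h : ln (kappa / 2) / N%:R @[N --> \oo] --> (ln (kappa / 2) * 0 : R).
    apply: cvgM; first exact: cvg_cst.
    by rewrite -cvg_shiftS; exact: cvg_harmonic.
  rewrite mulr0 in h; move/cvgr0Pnorm_lt : h; apply.
  by rewrite divr_gt0.
near=> N.
have nN : (n <= N)%N by near: N; exact: nbhs_infty_ge.
have N0 : (0 < N)%N by exact: leq_trans nN.
have NR : 0 < N%:R :> R by rewrite ltr0n.
have Npos : N%:R != 0 :> R by rewrite gt_eqF.
have cN : expected_level_count gamma (fun i => ratr (y i)) N / 2 <=
    level_count xi (fun i => ratr (y i)) N w by near: N.
have lN : `|ln (kappa / 2) / N%:R| < eps / 2 by near: N.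
pose Y := \sum_(i < n) y' i `^ gamma / gamma.
have eN : 2 ^+ N * (kappa * expR (- (N%:R * Y))) <=
    expected_level_count gamma (fun i => ratr (y i)) N.
  rewrite ler_wpM2l ?exprn_ge0// /kappa /Y mulr_sumr -sumrN expR_sum.
  rewrite -big_split/=.
  apply: ler_prod => i _; have /andP[h1 h2] := yy' i.
  rewrite lower_tail_exp_le// andbT mulr_ge0 ?expR_ge0//.
  rewrite mulr_ge0 ?(ltW C0_gt0)//.
  by rewrite subr_ge0 ltW.
have ZN : expR (N%:R * (ln 2 - Y + beta * \sum_(i < n) a i.+1 * ratr (y i)) +
    ln (kappa / 2)) <= partition_function n a xi N beta w.
  apply: le_trans (partition_function_ge _ nN).
  apply: le_trans (ler_wpM2r (expR_ge0 _) cN).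
  apply: le_trans (ler_wpM2r (expR_ge0 _) (ler_wpM2r _ eN)).
    set W := beta * _.
    have -> : N%:R * (ln 2 - Y + W) + ln (kappa / 2) =
        N%:R * ln 2 + - (N%:R * Y) + N%:R * W + ln (kappa / 2) by ring.
    rewrite !expRD expRM_natl lnK ?posrE// lnK ?posrE ?divr_gt0//.
    by rewrite le_eqVlt; apply/orP; left; apply/eqP; ring.
  by rewrite invr_ge0.
have Z0 : 0 < partition_function n a xi N beta w.
  by apply: lt_le_trans ZN; exact: expR_gt0.
rewrite mulrC ler_pdivlMr//.
rewrite -ler_expR lnK ?posrE//; apply: le_trans ZN.
rewrite ler_expR [leLHS]mulrC.
have -> : ln (kappa / 2) = N%:R * (ln (kappa / 2) / N%:R).
  by rewrite mulrCA divff ?mulr1.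
rewrite -mulrDr ler_wpM2l// ?(ltW NR)//.
have hY : Y <= \sum_(i < n) x i.+1 `^ gamma / gamma.
  apply: ler_sum => i _; rewrite ler_wpM2r ?invr_ge0 ?(ltW g0)//.
  apply: ge0_ler_powR; rewrite ?nnegrE ?(ltW g0)//.
  - by rewrite mulr_ge0 ?ltW// x_gt0/=.
  - by rewrite ltW// x_gt0/=.
  - by rewrite ger_pMl ?ltW// x_gt0/=.
have hA : s ^+ 2 * A <= beta * \sum_(i < n) a i.+1 * ratr (y i).
  rewrite mulrCA ler_wpM2l ?(ltW beta_gt0)// mulr_sumr; apply: ler_sum => i _.
  rewrite mulrCA ler_wpM2l//; first by rewrite ltW// a_gt0/=.
  by case/andP: (hy i) => /ltW.
move: lN; rewrite ltr_norml => /andP[l1 l2].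
rewrite sumrB.
have -> : \sum_(i < n) beta * (a i.+1 * x i.+1) = A by rewrite -mulr_sumr.
by lra.
Unshelve. all: by end_near. Qed.

End LowerBound.

(** * Critical inverse temperatures *)

Section CriticalInverseTemperatures.
Variables (R : realType) (n : nat) (gamma : R) (p a : nat -> R).
Hypothesis n_ge1 : (1 <= n)%N.
Hypothesis gamma_gt1 : 1 < gamma.
Hypothesis a_gt0 : forall i, (1 <= i <= n)%N -> 0 < a i.
Hypothesis p_ge0 : forall i, (1 <= i <= n)%N -> 0 <= p i.
Hypothesis p1_gt0 : 0 < p 1%N.

Local Notation q := (gamma / (gamma - 1)).
Local Notation B := (B gamma p a).
Local Notation next_beta := (next_beta n gamma p a).
Local Notation next_r := (next_r n gamma p a).
Local Notation crit_r := (crit_r n gamma p a).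
Local Notation crit_beta := (crit_beta n gamma p a).
Local Notation crit_K := (crit_K n gamma p a).

Let g0 : 0 < gamma. Proof. exact: lt_trans gamma_gt1. Qed.
Let g1 : 0 < gamma - 1. Proof. by rewrite subr_gt0. Qed.
Let q0 : 0 < q. Proof. by rewrite divr_gt0. Qed.

(** Entropy of the levels [j..k] when they are kept at the inverse temperature
    [t]: the variable of level [i] is then about
    [- N * (t * a i) ^ (1 / (gamma - 1))], and the [gamma]-th power of
    [(t * a i) ^ (1 / (gamma - 1))] is [(t * a i) ^ q]. *)
Definition gap (t : R) (j k : nat) : R :=
  \sum_(j <= i < k.+1) (p i * ln 2 - (t * a i) `^ q / gamma).

Let ln2_gt0 : 0 < ln 2 :> R. Proof. by rewrite ln_gt0// ltr1n. Qed.

Lemma gapE t j k : 0 <= t -> (1 <= j)%N -> (k <= n)%N ->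
  gap t j k * gamma = (\sum_(j <= i < k.+1) p i) * gamma * ln 2 -
    t `^ q * \sum_(j <= i < k.+1) a i `^ q.
Proof.
move=> t0 j1 kn; rewrite !mulr_suml mulr_sumr -sumrB.
apply: eq_big_nat => i /andP[ji ik].
have ai : 0 < a i by rewrite a_gt0// (leq_trans j1 ji) (leq_trans _ kn).
rewrite powRM ?(ltW ai)//; field.
by rewrite gt_eqF.
Qed.

Let den_gt0 j k : (1 <= j <= k)%N -> (k <= n)%N ->
  0 < \sum_(j <= i < k.+1) a i `^ q.
Proof.
move=> /andP[j1 jk] kn; rewrite big_ltn//.
rewrite ltr_pwDl ?powR_gt0 ?a_gt0 ?j1 ?(leq_trans jk)//.
by apply: sumr_ge0 => i _; exact: powR_ge0.
Qed.

Let num_ge0 j k : (1 <= j)%N -> (k <= n)%N ->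
  0 <= (\sum_(j <= i < k.+1) p i) * gamma * ln 2.
Proof.
move=> j1 kn; rewrite !mulr_ge0 ?(ltW g0) ?(ltW ln2_gt0)//.
rewrite big_nat sumr_ge0// => i /andP[ji ik].
by rewrite p_ge0// (leq_trans j1 ji) (leq_trans _ kn).
Qed.

Let ratioE j k : (1 <= j <= k)%N -> (k <= n)%N ->
  (B j k) `^ q = (\sum_(j <= i < k.+1) p i) * gamma * ln 2 /
    \sum_(j <= i < k.+1) a i `^ q.
Proof.
move=> jk kn; rewrite /Defs.B -powRrM.
rewrite (_ : _ * q = 1); last by field; rewrite !gt_eqF.
rewrite powRr1// divr_ge0 ?num_ge0 ?(ltW (den_gt0 jk kn))//.
by case/andP: jk.
Qed.

Let lt_powq s t : 0 <= s -> 0 <= t -> (s `^ q < t `^ q) = (s < t).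
Proof.
move=> s0 t0; apply/idP/idP => [|h].
  apply: contraTT; rewrite -!leNgt => h.
  by apply: ge0_ler_powR; rewrite ?nnegrE ?(ltW q0).
by apply: gt0_ltr_powR; rewrite ?nnegrE.
Qed.

(** [B j k] is the inverse temperature that exhausts the entropy of the levels
    [j..k]. Entropy is additive in the levels, so comparisons of the [B] are
    best made through the sign of [gap]. *)
Lemma B_lt t j k : 0 <= t -> (1 <= j <= k)%N -> (k <= n)%N ->
  (B j k < t) = (gap t j k < 0).
Proof.
move=> t0 jk kn; have j1 : (1 <= j)%N by case/andP: jk.
rewrite -[RHS](pmulr_llt0 _ g0) gapE// subr_lt0.
rewrite -(ltr_pdivrMr _ _ (den_gt0 jk kn)) -ratioE//.
by rewrite lt_powq ?powR_ge0.
Qed.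

Lemma gap_B j k : (1 <= j <= k)%N -> (k <= n)%N -> gap (B j k) j k = 0.
Proof.
move=> jk kn; have j1 : (1 <= j)%N by case/andP: jk.
have : gap (B j k) j k * gamma = 0.
  rewrite gapE ?powR_ge0// ratioE// mulfVK ?subrr// gt_eqF//.
  exact: den_gt0.
by move/eqP; rewrite mulf_eq0 (gt_eqF g0) orbF => /eqP.
Qed.

Lemma lt_B t j k : 0 <= t -> (1 <= j <= k)%N -> (k <= n)%N ->
  (t < B j k) = (0 < gap t j k).
Proof.
move=> t0 jk kn; have j1 : (1 <= j)%N by case/andP: jk.
rewrite -[RHS](pmulr_lgt0 _ g0) gapE// subr_gt0.
rewrite -(ltr_pdivlMr _ _ (den_gt0 jk kn)) -ratioE//.
by rewrite lt_powq ?powR_ge0.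
Qed.

Lemma le_B t j k : 0 <= t -> (1 <= j <= k)%N -> (k <= n)%N ->
  (t <= B j k) = (0 <= gap t j k).
Proof. by move=> t0 jk kn; rewrite !leNgt B_lt. Qed.

Section OneStep.
Variable r : nat.
Hypothesis rn : (r < n)%N.

Lemma next_beta_le k : (r < k <= n)%N -> next_beta r <= B r.+1 k.
Proof.
move=> rk; rewrite /Defs.next_beta; apply: (@bigmin_inf_seq _ _ _ _ _ k) => //.
by rewrite mem_index_iota ltnS.
Qed.

Let next_beta_attained : exists2 k, (r < k <= n)%N & B r.+1 k = next_beta r.
Proof.
rewrite /Defs.next_beta big_nat.
elim/big_ind: _ => [|x y [i ri <-] [j rj <-]|i /andP[ri ik]].
- by exists n; rewrite ?rn/=.
- by rewrite minEle; case: ifP => _; [exists i|exists j].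
- by exists i => //=; apply/andP; split.
Qed.

Lemma next_r_spec : (r < next_r r <= n)%N /\ B r.+1 (next_r r) = next_beta r.
Proof.
have [k rk Bk] := next_beta_attained.
have kle : (k <= next_r r)%N.
  apply: (@leq_bigmax_seq _ _ _ id) => /=; last by rewrite Bk.
  by rewrite mem_index_iota ltnS.
have : next_r r = 0%N \/
    ((r < next_r r <= n)%N /\ B r.+1 (next_r r) = next_beta r).
  rewrite /Defs.next_r big_nat_cond.
  elim/big_ind: _ => [|i j hi hj|i /andP[/andP[ri ik] /eqP Bi]].
  - by left.
  - by rewrite /maxn; case: ifP.
  - by right; split=> //; rewrite ri.
case=> // r0; move: kle; rewrite r0 leqn0 => /eqP k0.
by move: rk; rewrite k0.
Qed.

Lemma next_beta_lt k : (next_r r < k <= n)%N -> next_beta r < B r.+1 k.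
Proof.
move=> /andP[rk kn]; have [/andP[rr _] _] := next_r_spec.
have rk' : (r < k)%N by exact: ltn_trans rk.
rewrite lt_neqAle next_beta_le ?rk'// andbT eq_sym; apply/negP => Bk.
have : (k <= next_r r)%N.
  apply: (@leq_bigmax_seq _ _ _ id) => //.
  by rewrite mem_index_iota rk' ltnS.
by rewrite leqNgt rk.
Qed.

End OneStep.

Lemma crit_r_le l : (crit_r l <= n)%N.
Proof.
elim: l => // l IH; rewrite /Defs.crit_r iterS -/(crit_r l).
rewrite /Defs.next_r big_nat_cond; elim/big_ind: _ => // [i j hi hj|i].
  by rewrite geq_max hi.
by case/andP => /andP[_]; rewrite ltnS.
Qed.

Lemma crit_rS l : crit_r l.+1 = next_r (crit_r l).
Proof. by rewrite /Defs.crit_r iterS. Qed.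

Lemma crit_r_lt l : (l < crit_K)%N -> (crit_r l < n)%N.
Proof.
move=> lK; rewrite ltn_neqAle crit_r_le andbT.
have := before_find 0%N lK; rewrite nth_iota ?add0n => [->//|].
by apply: leq_trans lK _; rewrite -[leqRHS](size_iota 0) find_size.
Qed.

Lemma crit_r_grow l : (forall i, (i < l)%N -> (crit_r i < n)%N) ->
  (l <= crit_r l)%N.
Proof.
elim: l => // l IH h.
have lr := IH (fun i il => h i (leqW il)).
apply: leq_ltn_trans lr _; rewrite crit_rS.
by have [/andP[]] := next_r_spec (h l (ltnSn _)).
Qed.

Lemma crit_r_K : crit_r crit_K = n.
Proof.
have : has (fun l => crit_r l == n) (iota 0 n.+1).
  apply/negPn/negP => /hasPn h.
  have hlt i : (i <= n)%N -> (crit_r i < n)%N.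
    move=> ile; rewrite ltn_neqAle crit_r_le andbT; apply: h.
    by rewrite mem_iota/= add0n ltnS.
  have := crit_r_grow (fun i (il : (i < n)%N) => hlt i (ltnW il)).
  by rewrite leqNgt hlt.
move=> hs; have := nth_find 0%N hs; rewrite nth_iota.
  by rewrite add0n => /eqP.
by rewrite -[ltnRHS](size_iota 0) -has_find.
Qed.

Lemma crit_r_ltS l : (l < crit_K)%N -> (crit_r l < crit_r l.+1)%N.
Proof.
by move=> /crit_r_lt /next_r_spec[/andP[]]; rewrite crit_rS.
Qed.

Lemma gap_cat t i j k : (i <= j)%N -> (j <= k)%N ->
  gap t i.+1 k = gap t i.+1 j + gap t j.+1 k.
Proof. by move=> ij jk; rewrite /gap -big_cat_nat. Qed.

Lemma gap_crit l : (l < crit_K)%N ->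
  gap (crit_beta l.+1) (crit_r l).+1 (crit_r l.+1) = 0.
Proof.
move=> lK; have rn := crit_r_lt lK.
have [/andP[rr rle] Bn] := next_r_spec rn.
by rewrite crit_rS /= -Bn gap_B//= ltnS.
Qed.

Lemma crit_beta_ge0 l : 0 <= crit_beta l.
Proof.
case: l => //= l; rewrite /Defs.next_beta.
elim/big_ind: _ => [|x y x0 y0|i _]; rewrite ?powR_ge0//.
by rewrite le_min x0.
Qed.

(** At the critical value of a block the gap of the block is zero, while by
    maximality of the block the gap of any longer segment is positive; the
    difference is the gap of the segment that follows the block. *)
Lemma crit_beta_lt l : (l < crit_K)%N -> crit_beta l < crit_beta l.+1.
Proof.
case: l => [|l] lK.
  have [/andP[r0 rn] B0] := next_r_spec n_ge1.
  have -> : crit_beta 1 = B 1 (next_r 0) by rewrite B0.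
  have -> : crit_beta 0 = 0 by [].
  rewrite lt_B// /gap big_ltn// ltr_pwDl//.
    by rewrite mul0r powR0 ?gt_eqF// mul0r subr0 mulr_gt0.
  rewrite big_nat sumr_ge0// => i /andP[i1 ir].
  rewrite mul0r powR0 ?gt_eqF// mul0r subr0 mulr_ge0 ?(ltW ln2_gt0)// p_ge0//.
  by rewrite (ltnW i1) (leq_trans _ rn).
have lK' := ltnW lK; have rn := crit_r_lt lK'; have rn' := crit_r_lt lK.
have [/andP[rr rle] Bn] := next_r_spec rn.
have := next_r_spec rn'; set k := next_r (crit_r l.+1) => -[/andP[rk kn] Bk].
have b0 := crit_beta_ge0 l.+1.
have rr' := crit_r_ltS lK'.
have -> : crit_beta l.+2 = B (crit_r l.+1).+1 k by rewrite Bk.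
rewrite lt_B//.
have : 0 < gap (crit_beta l.+1) (crit_r l).+1 k.
  rewrite -lt_B//=; first by apply: next_beta_lt; rewrite // -crit_rS rk.
  by rewrite (leq_trans rr')// ltnW.
by rewrite (gap_cat _ (ltnW rr') (ltnW rk)) gap_crit// add0r.
Qed.

End CriticalInverseTemperatures.

Section LevelInverseTemperatures.
Variables (R : realType) (n : nat) (gamma : R) (p a : nat -> R).
Hypothesis n_ge1 : (1 <= n)%N.
Hypothesis gamma_gt1 : 1 < gamma.
Hypothesis a_gt0 : forall i, (1 <= i <= n)%N -> 0 < a i.
Hypothesis p_ge0 : forall i, (1 <= i <= n)%N -> 0 <= p i.
Hypothesis p1_gt0 : 0 < p 1%N.

Local Notation q := (gamma / (gamma - 1)).
Local Notation crit_r := (crit_r n gamma p a).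
Local Notation crit_beta := (crit_beta n gamma p a).
Local Notation crit_K := (crit_K n gamma p a).

Let g0 : 0 < gamma. Proof. exact: lt_trans gamma_gt1. Qed.
Let g1 : 0 < gamma - 1. Proof. by rewrite subr_gt0. Qed.

(** A level of one of the first [j] blocks is frozen at the critical value of
    its block; the other levels follow [beta]. The recursion removes the last
    frozen block by lowering [beta] to the critical value of that block. *)
Fixpoint level_beta (j : nat) (beta : R) (i : nat) : R :=
  if j is l.+1 then
    if (crit_r l.+1 < i)%N then beta else level_beta l (crit_beta l.+1) i
  else beta.

Lemma crit_beta_gt0 l : (l < crit_K)%N -> 0 < crit_beta l.+1.
Proof.
move=> lK; apply: le_lt_trans (crit_beta_ge0 n gamma p a l) _.
exact: crit_beta_lt.
Qed.

Lemma level_beta_itv j beta i : (j <= crit_K)%N -> crit_beta j <= beta ->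
  0 < beta -> 0 < level_beta j beta i <= beta.
Proof.
elim: j beta => [|j IH] beta jK bj b0 /=; first by rewrite b0 lexx.
case: ifP => _; first by rewrite b0 lexx.
have /andP[h1 h2] := IH (crit_beta j.+1) (ltnW jK)
  (ltW (crit_beta_lt n_ge1 gamma_gt1 a_gt0 p_ge0 p1_gt0 jK)) (crit_beta_gt0 jK).
by rewrite h1 (le_trans h2).
Qed.

Lemma level_beta_mono j beta i i' : (j <= crit_K)%N -> crit_beta j <= beta ->
  0 < beta -> (i <= i')%N -> level_beta j beta i <= level_beta j beta i'.
Proof.
elim: j beta => [|j IH] beta jK bj b0 ii' /=; first exact: lexx.
have bS := ltW (crit_beta_lt n_ge1 gamma_gt1 a_gt0 p_ge0 p1_gt0 jK).
have b1 := crit_beta_gt0 jK.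
case: (ltnP _ i) => h; first by rewrite (leq_trans h ii').
case: (ltnP _ i') => h'; last exact: IH (ltnW jK) bS b1 ii'.
have /andP[_ h2] := level_beta_itv i (ltnW jK) bS b1.
exact: le_trans h2 bj.
Qed.

Lemma sum_level_beta (G : nat -> R -> R) j beta m : (j <= crit_K)%N ->
  (crit_r j <= m)%N ->
  \sum_(1 <= i < m.+1) G i (level_beta j beta i) =
  \sum_(1 <= l < j.+1)
    \sum_((crit_r l.-1).+1 <= i < (crit_r l).+1) G i (crit_beta l) +
  \sum_((crit_r j).+1 <= i < m.+1) G i beta.
Proof.
elim: j beta m => [|j IH] beta m jK jm.
  by rewrite [X in X + _]big_geq// add0r.
have rr := crit_r_ltS jK.
rewrite (@big_cat_nat _ _ _ (crit_r j.+1).+1)//=.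
have -> : \sum_(1 <= i < (crit_r j.+1).+1) G i (level_beta j.+1 beta i) =
    \sum_(1 <= i < (crit_r j.+1).+1) G i (level_beta j (crit_beta j.+1) i).
  apply: eq_big_nat => i /andP[_]; rewrite ltnS => ir /=.
  by rewrite ltnNge ir.
rewrite IH ?(ltnW jK) ?(ltnW rr)// [in RHS]big_nat_recr//=.
congr (_ + _); apply: eq_big_nat => i /andP[ri _].
by rewrite ri.
Qed.

(** Whole frozen blocks contribute nothing. The last, incomplete one is an
    initial segment of a remaining block, whose entropy is nonnegative because
    [beta] does not exceed the next critical value, a minimum over such
    segments. *)
Lemma level_beta_feasible j beta m : (j <= crit_K)%N -> 0 < beta ->
  crit_beta j <= beta -> ((j < crit_K)%N -> beta <= crit_beta j.+1) ->
  (m <= n)%N ->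
  0 <= \sum_(1 <= i < m.+1)
         (p i * ln 2 - (level_beta j beta i * a i) `^ q / gamma).
Proof.
elim: j beta => [|j IH] beta jK b0 bj jb mn.
  rewrite -/(gap gamma p a beta 1 m).
  have [m0|m0] := posnP m; first by rewrite /gap m0 big_geq.
  have n0 : (0 < n)%N by [].
  rewrite -(le_B gamma_gt1 a_gt0 p_ge0) ?(ltW b0)//.
  apply: le_trans (jb _) _; last by apply: next_beta_le; rewrite // m0.
  rewrite lt0n; apply/eqP => K0; have := crit_r_K n gamma p a.
  by rewrite K0 => /eqP; rewrite eq_sym (gtn_eqF n0).
have bS := ltW (crit_beta_lt n_ge1 gamma_gt1 a_gt0 p_ge0 p1_gt0 jK).
have b1 := crit_beta_gt0 jK.
have [mr|rm] := leqP m (crit_r j.+1).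
  have := IH (crit_beta j.+1) (ltnW jK) b1 bS (fun _ => lexx _) mn.
  congr (_ <= _); apply: eq_big_nat => i /andP[_]; rewrite ltnS => im.
  by rewrite /= ltnNge (leq_trans im mr).
rewrite (sum_level_beta (fun i t => p i * ln 2 - (t * a i) `^ q / gamma) _ jK
  (ltnW rm)).
rewrite big_nat big1 ?add0r => [|l /andP[l1 lj]]; last first.
  case: l l1 lj => // l _ lj; apply: (gap_crit gamma_gt1 a_gt0 p_ge0).
  exact: leq_trans jK.
rewrite -/(gap gamma p a beta _ _) -(le_B gamma_gt1 a_gt0 p_ge0) ?(ltW b0)//.
have jK' : (j.+1 < crit_K)%N.
  rewrite ltn_neqAle jK andbT; apply/eqP => jE.
  have := crit_r_K n gamma p a; rewrite -jE => rE.
  by move: rm; rewrite rE ltnNge mn.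
apply: le_trans (jb jK') _; apply: next_beta_le.
by rewrite rm.
Qed.

Let frozen_entropy t j k : 0 < t -> (1 <= j)%N -> (k <= n)%N ->
  gap gamma p a t j k = 0 ->
  \sum_(j <= i < k.+1) p i * ln 2 =
  t * t `^ (gamma - 1)^-1 * (\sum_(j <= i < k.+1) a i `^ q) / gamma.
Proof.
move=> t0 j1 kn; rewrite /gap sumrB => /eqP; rewrite subr_eq0 => /eqP ->.
rewrite mulr_sumr mulr_suml; apply: eq_big_nat => i /andP[ji ik].
have ai : 0 < a i by rewrite a_gt0// (leq_trans j1 ji) (leq_trans _ kn).
rewrite powRM ?(ltW ai) ?(ltW t0)//; congr (_ * _ / _).
exact: powR_conjugate.
Qed.

Definition limit_free_energy (j : nat) (beta : R) : R :=
  (\sum_((crit_r j).+1 <= i < n.+1) p i) * ln 2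
  + (gamma - 1) / gamma *
      (\sum_((crit_r j).+1 <= i < n.+1) (beta * a i) `^ q)
  + beta * \sum_(1 <= l < j.+1) crit_beta l `^ (gamma - 1)^-1 *
      (\sum_((crit_r l.-1).+1 <= i < (crit_r l).+1) a i `^ q).

Let hot_power t i : 0 < t -> (1 <= i <= n)%N ->
  (t * a i) `^ q = t * t `^ (gamma - 1)^-1 * a i `^ q.
Proof.
move=> t0 i1; rewrite powRM ?(ltW t0) ?(ltW (a_gt0 _))//; congr (_ * _).
exact: powR_conjugate.
Qed.

(** The value produced by the upper bound. On a frozen block the entropy
    [p i * ln 2] sums to [1 / gamma] times the sum of [(t * a i) ^ q], which
    completes the term with factor [1 / q]. *)
Lemma limit_free_energy_dual j beta : (j <= crit_K)%N -> 0 < beta ->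
  \sum_(1 <= i < n.+1)
    (beta * level_beta j beta i `^ (gamma - 1)^-1 * a i `^ q / q +
     beta / level_beta j beta i * (p i * ln 2)) = limit_free_energy j beta.
Proof.
move=> jK b0; rewrite (sum_level_beta (fun i t =>
  beta * t `^ (gamma - 1)^-1 * a i `^ q / q + beta / t * (p i * ln 2)) _ jK
  (crit_r_le _ _ _ _ _)).
rewrite addrC /limit_free_energy; congr (_ + _).
  rewrite mulr_suml mulr_sumr -big_split/=; apply: eq_big_nat => i /andP[ri ik].
  have i1 : (1 <= i <= n)%N by rewrite (leq_trans _ ri).
  rewrite hot_power//; field.
  by rewrite !gt_eqF.
rewrite mulr_sumr; apply: eq_big_nat => l /andP[l1 lj].
case: l l1 lj => // l _ lj; rewrite succnK.
have lK : (l < crit_K)%N by exact: leq_trans jK.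
have t0 := crit_beta_gt0 lK; have gp := gap_crit gamma_gt1 a_gt0 p_ge0 lK.
have fe := frozen_entropy t0 (ltn0Sn _) (crit_r_le _ _ _ _ _) gp.
move: (crit_beta l.+1) t0 gp fe => t t0 _ fe.
rewrite big_split/= -mulr_suml -!mulr_sumr fe.
by field; rewrite !gt_eqF.
Qed.

(** The value produced by the lower bound. On a frozen block the entropies
    cancel and only the energy remains. *)
Lemma limit_free_energy_primal j beta : (j <= crit_K)%N -> 0 < beta ->
  \sum_(1 <= i < n.+1)
    (p i * ln 2 + (beta * (level_beta j beta i `^ (gamma - 1)^-1 * a i `^ q) -
     (level_beta j beta i * a i) `^ q / gamma)) = limit_free_energy j beta.
Proof.
move=> jK b0; rewrite (sum_level_beta (fun i t =>
  p i * ln 2 + (beta * (t `^ (gamma - 1)^-1 * a i `^ q) -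
    (t * a i) `^ q / gamma)) _ jK (crit_r_le _ _ _ _ _)).
rewrite addrC /limit_free_energy; congr (_ + _).
  rewrite mulr_suml mulr_sumr -big_split/=; apply: eq_big_nat => i /andP[ri ik].
  have i1 : (1 <= i <= n)%N by rewrite (leq_trans _ ri).
  rewrite hot_power//; field.
  by rewrite !gt_eqF.
rewrite mulr_sumr; apply: eq_big_nat => l /andP[l1 lj].
case: l l1 lj => // l _ lj; rewrite succnK.
have lK : (l < crit_K)%N by exact: leq_trans jK.
have gp := gap_crit gamma_gt1 a_gt0 p_ge0 lK.
move: (crit_beta l.+1) gp => t gp.
rewrite !mulr_sumr; set S := \sum_(_ <= i < _) beta * _.
rewrite -[S]addr0 -[X in S + X]gp /gap -big_split/=.
by apply: eq_bigr => i _; ring.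
Qed.

End LevelInverseTemperatures.

(** * The limit *)

Section FreeEnergy.
Context d (T : measurableType d) (R : realType) (P : probability T R).
Variables (k : nat -> nat -> nat) (n : nat) (gamma : R) (a p : nat -> R).
Variable xi : forall N i : nat, (prefix_len k N i).-tuple bool -> {RV P >-> R}.
Arguments xi : clear implicits.
Hypothesis n_ge1 : (1 <= n)%N.
Hypothesis gamma_gt1 : 1 < gamma.
Hypothesis a_gt0 : forall i, (1 <= i <= n)%N -> 0 < a i.
Hypothesis k_sum : forall N, (n <= N)%N -> (\sum_(1 <= i < n.+1) k i N)%N = N.
Hypothesis k_lim : forall i, (1 <= i <= n)%N ->
  (k i N)%:R / N%:R @[N --> \oo] --> p i.
Hypothesis p1_gt0 : 0 < p 1%N.
Hypothesis xi_density : forall N i (s : (prefix_len k N i).-tuple bool),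
  (n <= N)%N -> (1 <= i <= n)%N ->
  has_density (xi N i s) (driving_density N gamma).

Local Notation q := (gamma / (gamma - 1)).
Local Notation crit_beta := (crit_beta n gamma p a).
Local Notation crit_K := (crit_K n gamma p a).

Lemma proportion_ge0 i : (1 <= i <= n)%N -> 0 <= p i.
Proof.
move=> i1; apply: (cvgr_to_ge (k_lim i1)).
by apply: nearW => N; rewrite divr_ge0.
Qed.

Lemma sum_proportions : \sum_(i < n) p i.+1 = 1.
Proof.
have h : \sum_(i < n) (k i.+1 N)%:R / N%:R @[N --> \oo] -->
    \sum_(i < n) p i.+1.
  by apply: cvg_sum_ord => i; apply: k_lim; rewrite /= ltn_ord.
rewrite -(cvg_lim _ h)//; apply/cvg_lim => //.
apply: cvg_near_cst; exists n => // N /= nN.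
rewrite -mulr_suml -natr_sum.
have := k_sum nN; rewrite big_add1/= big_mkord => ->.
by rewrite divff// pnatr_eq0 -lt0n (leq_trans n_ge1).
Qed.

(** Both bounds are applied to [level_beta]; the lower one at the values for
    which Young's inequality, in the upper one, becomes an equality. *)
Lemma free_energy_cvg (w : T) (beta : R) (j : nat) :
  tilted_sums_bounded n gamma xi w -> level_counts_large n gamma xi w ->
  0 < beta -> (j <= crit_K)%N -> crit_beta j <= beta ->
  ((j < crit_K)%N -> beta <= crit_beta j.+1) ->
  N%:R^-1 * ln (partition_function n a xi N beta w) @[N --> \oo] -->
  limit_free_energy n gamma p a j beta.
Proof.
move=> tilted_w count_w b0 jK bj jb.
have p_ge0 := proportion_ge0.
pose b := level_beta n gamma p a j beta.
have b_itv i : 0 < b i <= beta by exact: level_beta_itv.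
have b_gt0 i : 0 < b i by case/andP: (b_itv i).
have b_le i : b i <= beta by case/andP: (b_itv i).
have b_mono i : b i <= b i.+1 by exact: level_beta_mono.
have g0 : 0 < gamma by exact: lt_trans gamma_gt1.
have g1 : 0 < gamma - 1 by rewrite subr_gt0.
pose x i := (b i * a i) `^ (gamma - 1)^-1.
have ba_gt0 i : (1 <= i <= n)%N -> 0 < b i * a i.
  by move=> i1; rewrite mulr_gt0// a_gt0.
have xE i : x i `^ gamma = (b i * a i) `^ q.
  by rewrite /x -powRrM; congr (_ `^ _); rewrite mulrC.
have feas i : (i <= n)%N ->
    \sum_(l < i) x l.+1 `^ gamma / gamma <= \sum_(l < i) p l.+1 * ln 2.
  move=> ile; have := level_beta_feasible n_ge1 gamma_gt1 a_gt0 p_ge0 p1_gt0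
    jK b0 bj jb ile.
  rewrite big_add1/= big_mkord sumrB subr_ge0; congr (_ <= _).
  by apply: eq_bigr => l _; rewrite xE.
have dual := limit_free_energy_dual n_ge1 gamma_gt1 a_gt0 p_ge0 p1_gt0 jK b0.
have primal := limit_free_energy_primal gamma_gt1 a_gt0 p_ge0 jK b0.
have sumpl : \sum_(i < n) p i.+1 * ln 2 = ln 2.
  by rewrite -mulr_suml sum_proportions mul1r.
apply/cvgrPdist_le => eps eps0.
have up := free_energy_le n_ge1 gamma_gt1 k_sum k_lim a_gt0 b0
  (fun i _ => b_gt0 i) (fun i _ => b_le i) (fun i _ => b_mono i) tilted_w eps0.
have lo := free_energy_ge n_ge1 gamma_gt1 k_lim p_ge0 p1_gt0 a_gt0 b0
  xi_density (fun i i1 => powR_gt0 _ (ba_gt0 i i1)) feas count_w eps0.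
near=> N; rewrite ler_distlC; apply/andP; split.
  rewrite -primal.
  apply: (@le_trans _ _ (ln 2 + \sum_(i < n) (beta * (a i.+1 * x i.+1) -
    x i.+1 `^ gamma / gamma) - eps)); last by near: N.
  rewrite lerD2r -{2}sumpl -big_split big_add1/= big_mkord.
  rewrite le_eqVlt; apply/orP; left; apply/eqP; apply: eq_bigr => i _ /=.
  have i1 : (1 <= i.+1 <= n)%N by rewrite /= ltn_ord.
  rewrite xE -/b; congr (_ + (beta * _ - _)).
  rewrite /x powRM ?(ltW (b_gt0 _)) ?(ltW (a_gt0 i1))// mulrCA; congr (_ * _).
  by rewrite powR_conjugate ?a_gt0.
rewrite -dual big_add1/= big_mkord big_split/=.
apply: (@le_trans _ _ (\sum_(i < n) beta * b i.+1 `^ (gamma - 1)^-1 *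
   a i.+1 `^ q / q + \sum_(i < n) (beta / b i.+1 - 1) * (p i.+1 * ln 2) +
   ln 2 + eps)); first by near: N.
rewrite lerD2r -addrA lerD2l -{2}sumpl -big_split/=.
rewrite le_eqVlt; apply/orP; left; apply/eqP; apply: eq_bigr => i _ /=.
by rewrite -/b; ring.
Unshelve. all: by end_near. Qed.

End FreeEnergy.

Unset Implicit Arguments.
Set Strict Implicit.

Theorem theorem2p6p1 (R : realType) (d : measure_display)
  (T : measurableType d) (P : probability T R)
  (n : nat) (gamma : R) (a p : nat -> R) (k : nat -> nat -> nat)
  (xi : forall N i : nat, (prefix_len k N i).-tuple bool -> {RV P >-> R})
  (n_ge1 : (1 <= n)%N)
  (gamma_gt1 : 1 < gamma)
  (a_gt0 : forall i, (1 <= i <= n)%N -> 0 < a i)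
  (k_ge1 : forall N i, (n <= N)%N -> (1 <= i <= n)%N -> (1 <= k i N)%N)
  (k_sum : forall N, (n <= N)%N -> (\sum_(1 <= i < n.+1) k i N)%N = N)
  (k_lim : forall i, (1 <= i <= n)%N ->
     (k i N)%:R / N%:R @[N --> \oo] --> p i)
  (p1_gt0 : 0 < p 1%N)
  (xi_indep : forall N, (n <= N)%N ->
     mutually_independent
       (fun u : spin_prefix_index k n N => xi N (tag u).+1 (tagged u)))
  (xi_density : forall N i (s : (prefix_len k N i).-tuple bool),
     (n <= N)%N -> (1 <= i <= n)%N ->
     has_density (xi N i s) (driving_density N gamma)) :
  let r := crit_r n gamma p a in
  let beta_ := crit_beta n gamma p a in
  let K := crit_K n gamma p a in
  {ae P, forall w, forall beta : R, 0 < beta ->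
    (forall j, (j < K)%N -> beta_ j < beta <= beta_ j.+1 ->
       N%:R^-1 * ln (partition_function n a xi N beta w) @[N --> \oo] -->
         (\sum_((r j).+1 <= i < n.+1) p i) * ln 2
         + (gamma - 1) / gamma *
             (\sum_((r j).+1 <= i < n.+1) (beta * a i) `^ (gamma / (gamma - 1)))
         + beta * \sum_(1 <= l < j.+1) beta_ l `^ (gamma - 1)^-1 *
             (\sum_((r l.-1).+1 <= i < (r l).+1) a i `^ (gamma / (gamma - 1))))
    /\
    (beta_ K < beta ->
       N%:R^-1 * ln (partition_function n a xi N beta w) @[N --> \oo] -->
         beta * \sum_(1 <= l < K.+1) beta_ l `^ (gamma - 1)^-1 *
           (\sum_((r l.-1).+1 <= i < (r l).+1) a i `^ (gamma / (gamma - 1))))}.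
Proof.
move=> r beta_ K.
have gK : crit_r n gamma p a K = n by exact: crit_r_K.
have kN N : (n <= N)%N -> (prefix_len k N n <= N)%N.
  by move=> nN; rewrite prefix_len_total.
have := ae_tilted_sums_bounded n_ge1 gamma_gt1 xi_indep xi_density.
have := ae_level_counts_large n_ge1 gamma_gt1 kN xi_indep xi_density.
apply: filterS2 => w count_w tilted_w beta b0; split.
  move=> j jK /andP[bj bj1].
  by apply: (free_energy_cvg n_ge1 gamma_gt1 a_gt0 k_sum k_lim p1_gt0
    xi_density tilted_w count_w b0 (ltnW jK) (ltW bj)).
move=> bK.
have := free_energy_cvg n_ge1 gamma_gt1 a_gt0 k_sum k_lim p1_gt0
  xi_density tilted_w count_w b0 (leqnn K) (ltW bK) _.
rewrite ltnn /limit_free_energy gK big_geq// mul0r add0r.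
by rewrite big_geq// mulr0 add0r; apply.
Qed.
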